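(* Let $g\in L^2(\mathbb R)$ and $a,b>0$. Then $G(g,a,b)$ is a Bessel sequence in $L^2(\mathbb R)$ with a Bessel bound $B$ (respectively, a frame with frame bounds $A$ and $B$) if and only if the sequence $(T_{na}(\frac{1}{\sqrt b}g))_{n\in\mathbb Z}$ is a weak Bessel sequence with a Bessel bound $B$ (respectively, a weak frame with frame bounds $A$ and $B$) in the Hilbert $L^{\infty}[0,\frac1b]$-module $L_{1/b}^{\infty}(\ell^2)$.
   Context: $T_cf(x)=f(x-c)$, $M_cf(x)=e^{2\pi icx}f(x)$; the Gabor system $G(g,a,b)$ is the family $(M_{mb}T_{na}g)_{m,n\in\mathbb Z}$ in $L^2(\mathbb R)$. For $c>0$, $L_c^{\infty}(\ell^2)=\{f:\mathbb R\to\mathbb C\text{ measurable}: \operatorname{ess\,sup}_{x\in[0,c]}\sum_{k\in\mathbb Z}|f(x-kc)|^2<\infty\}$ (functions identified a.e.). It is a self-dual left Hilbert $C^*$-module over the von Neumann algebra $L^\infty[0,c]$ (acting by multiplication on $L^2[0,c]$), with action $(h,f)\mapsto h^cf$, $h^c$ being the $c$-periodic extension of $h$, and inner product $\langle f,g\rangle_{L_c^\infty(\ell^2)}(x)=\sum_{k\in\mathbb Z}f(x-kc)\overline{g(x-kc)}$. A sequence $(x_n)_{n\in\mathbb Z}$ of elements of a self-dual Hilbert module $X$ over a von Neumann algebra is a weak Bessel sequence with Bessel bound $B$ if $(\text{strong})\sum_{n}\langle x,x_n\rangle \langle x,x_n\rangle^*\le B\langle x,x\rangle$ for all $x\in X$,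 and a weak frame with frame bounds $A,B>0$ if moreover $A\langle x,x\rangle\le(\text{strong})\sum_{n}\langle x,x_n\rangle \langle x,x_n\rangle^*$ for all $x\in X$; convergence is in the strong operator topology and is part of the requirement. Being such a sequence in $X$ includes that all its members belong to $X$. *)

(* Defs.v *)
From HB Require Import structures.
From mathcomp Require Import all_boot all_order all_algebra.
From mathcomp Require Import complex finmap.
From mathcomp Require Import all_classical all_reals all_analysis ess_sup_inf.

Set Implicit Arguments.
Unset Strict Implicit.
Unset Printing Implicit Defensive.

Import Order.TTheory GRing.Theory Num.Theory.
Import numFieldNormedType.Exports.

Local Open Scope classical_set_scope.
Local Open Scope complex_scope.
Local Open Scope ring_scope.

(* Elements of function spaces are represented by functions R -> R[i]; all the
   notions below are invariant under modification on a null set.  A family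
   indexed by Z is a function on [int]. *)

(* |z|^2 as a real number (the norm of R[i] takes its values in R[i]) *)
Definition sqmod (R : realType) (z : R[i]) : R :=
  complex.Re z ^+ 2 + complex.Im z ^+ 2.

Definition cmeasurable (R : realType) (D : set R) (f : R -> R[i]) : Prop :=
  measurable_fun D (fun x => complex.Re (f x)) /\
  measurable_fun D (fun x => complex.Im (f x)).

Definition cintegral (R : realType) (D : set R) (f : R -> R[i]) : R[i] :=
  Rintegral lebesgue_measure D (fun x => complex.Re (f x)) +i*
  Rintegral lebesgue_measure D (fun x => complex.Im (f x)).

(* Value of an absolutely convergent family of reals; as for [Rintegral], the
   positive and negative parts are summed separately. *)
Definition rsum (R : realType) (I : choiceType) (u : I -> R) : R :=
  fine (\esum_(i in [set: I]) (Num.max (u i) 0)%:E) -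
  fine (\esum_(i in [set: I]) (Num.max (- u i) 0)%:E).

Definition csum (R : realType) (I : choiceType) (u : I -> R[i]) : R[i] :=
  rsum (fun i => complex.Re (u i)) +i* rsum (fun i => complex.Im (u i)).

Section L2.
Context {R : realType}.
Implicit Types (D : set R) (f g : R -> R[i]).

Definition L2norm_sq D f : \bar R :=
  (\int[lebesgue_measure]_(x in D) (sqmod (f x))%:E)%E.

Definition L2 D : set (R -> R[i]) :=
  [set f | cmeasurable D f /\ (L2norm_sq D f < +oo)%E].

Definition L2inner D f g : R[i] := cintegral D (fun x => f x * (g x)^*%C).

Definition bessel (I : choiceType) D (e : I -> R -> R[i]) (B : R) : Prop :=
  (forall i, L2 D (e i)) /\
  (forall f, L2 D f ->
    (\esum_(i in [set: I]) (sqmod (L2inner D f (e i)))%:E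
       <= B%:E * L2norm_sq D f)%E).

Definition frame (I : choiceType) D (e : I -> R -> R[i]) (A B : R) : Prop :=
  [/\ 0 < A, 0 < B, bessel D e B &
    forall f, L2 D f ->
      (A%:E * L2norm_sq D f
         <= \esum_(i in [set: I]) (sqmod (L2inner D f (e i)))%:E)%E].

End L2.

Section Gabor.
Context {R : realType}.
Implicit Types (f g : R -> R[i]).

Definition translation (c : R) f : R -> R[i] := fun x => f (x - c).

Definition modulation (c : R) f : R -> R[i] :=
  fun x => (cos (2 * pi * c * x) +i* sin (2 * pi * c * x)) * f x.

Definition gabor g (a b : R) (mn : int * int) : R -> R[i] :=
  modulation (mn.1%:~R * b) (translation (mn.2%:~R * a) g).

End Gabor.

(* The von Neumann algebra L^oo[0,c] acting by multiplication on L^2[0,c] *)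
Section Linf.
Context {R : realType}.
Variable c : R.
Implicit Types (p q s h : R -> R[i]).

Definition ess_sup0c (F : R -> \bar R) : \bar R :=
  ess_sup (mrestr lebesgue_measure (measurable_itv `[0, c])) F.

Definition Linf : set (R -> R[i]) :=
  [set p | cmeasurable `[0, c] p /\
    (ess_sup0c (fun x => (Num.sqrt (sqmod (p x)))%:E) < +oo)%E].

(* order of a C*-algebra: q - p = k^* k for some element k *)
Definition Linf_le p q : Prop :=
  exists2 k, Linf k &
    {ae lebesgue_measure, forall x : R, x \in `[0, c] ->
       q x - p x = (k x)^*%C * k x}.

(* s is the sum, in the strong operator topology, of the multiplication
   operators by the p n: the net of the sums over finite subsets of Z,
   directed by inclusion, converges strongly. *)
Definition strong_sum (p : int -> R -> R[i]) s : Prop :=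
  [/\ forall n, Linf (p n), Linf s &
   forall h, L2 `[0, c] h -> forall e : R, 0 < e ->
   exists F0 : {fset int}, forall F : {fset int}, (F0 `<=` F)%fset ->
     (L2norm_sq `[0%R, c]
        (fun x => ((\sum_(n <- F) p n x * h x) - s x * h x)%R)
      < (e ^+ 2)%:E)%E].

(* Weak Bessel sequences and weak frames in a Hilbert L^oo[0,c]-module with
   set of elements X and L^oo[0,c]-valued inner product ip *)
Definition weak_bessel (T : Type) (X : set T) (ip : T -> T -> R -> R[i])
    (e : int -> T) (B : R) : Prop :=
  (forall n, X (e n)) /\
  (forall f, X f -> exists2 s,
     strong_sum (fun n x => ip f (e n) x * (ip f (e n) x)^*%C) s &
     Linf_le s (fun x => B%:C * ip f f x)).

Definition weak_frame (T : Type) (X : set T) (ip : T -> T -> R -> R[i])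
    (e : int -> T) (A B : R) : Prop :=
  [/\ 0 < A, 0 < B, weak_bessel X ip e B &
   forall f, X f -> exists2 s,
     strong_sum (fun n x => ip f (e n) x * (ip f (e n) x)^*%C) s &
     Linf_le (fun x => A%:C * ip f f x) s].

(* L_c^oo(l^2) *)
Definition Linf_l2 : set (R -> R[i]) :=
  [set f | cmeasurable [set: R] f /\
    (ess_sup0c (fun x =>
       \esum_(k in [set: int]) (sqmod (f (x - k%:~R * c)))%:E) < +oo)%E].

Definition Linf_l2_inner (f g : R -> R[i]) : R -> R[i] := fun x =>
  csum (fun k : int => f (x - k%:~R * c) * (g (x - k%:~R * c))^*%C).

End Linf.

(* Main.v *)
(* Let <f,h>(x) = sum_k f(x - kc) conj(h(x - kc)) with c = 1/b.  Unfolding the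
   integral over R along the translates of [0,c] shows that the inner product of f
   with M_{mb} h is the m-th Fourier coefficient of <f,h> on [0,c], so that by
   Parseval, with e_n = T_{na} g / sqrt b,
     sum_{m,n} |(f, M_{mb} T_{na} g)|^2 = int_0^c sum_n |<f,e_n>(x)|^2 dx,
   while the squared norm of f in L^2(R) is int_0^c <f,f>(x) dx.  Applying a
   Bessel or frame inequality to the products of f with indicators of c-periodic
   sets localizes it to almost every x; conversely, a fibrewise inequality for
   bounded <f,f> reaches every f in L^2(R) by dividing f by sqrt <f,f>.
   Parseval on [0,c]: by the parallelogram law and Bessel's inequality, the
   functions satisfying it are closed under sums and L^2 limits; intervals are
   treated with the Fejer kernel. *)
Require Import Defs.
From HB Require Import structures.
From mathcomp Require Import all_boot all_order all_algebra.
From mathcomp Require Import complex finmap ring lra.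
From mathcomp Require Import all_classical all_reals all_analysis.
From mathcomp Require Import measurable_realfun ess_sup_inf.

Set Implicit Arguments.
Unset Strict Implicit.
Unset Printing Implicit Defensive.

Import Order.TTheory GRing.Theory Num.Theory.
Import numFieldNormedType.Exports HBNNSimple.

Local Open Scope classical_set_scope.
Local Open Scope complex_scope.
Local Open Scope ring_scope.

(** The delicate point is membership. Parseval needs <f,e_n> in L^2[0,c], but for f and e_n in
    L^2(R) the bracket is in general only integrable, and a Bessel hypothesis does not say at the
    outset that e_n lies in L_c^oo(l^2). Membership is therefore extracted first: the Bessel
    inequality, tested on e_n cut to the periodic set where p = <e_n,e_n> is at most N and reduced
    to the n-th bracket, gives p^2 <= B p there, hence p <= B almost everywhere. From then on the
    pointwise Cauchy-Schwarz inequality puts <f,e_n> in L^2[0,c] for every f in L^2(R). The factor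
    1/sqrt b compensates the factor c that Parseval carries for unnormalized coefficients, since b c
    = 1. In the Bessel statement B is an arbitrary real, so its sign has to be settled in both
    directions. *)

Section complex_algebra.
Context {R : realType}.
Implicit Types z w : R[i].

Lemma cReD z w : complex.Re (z + w) = complex.Re z + complex.Re w.
Proof. by case: z; case: w. Qed.

Lemma cImD z w : complex.Im (z + w) = complex.Im z + complex.Im w.
Proof. by case: z; case: w. Qed.

Lemma cReN z : complex.Re (- z) = - complex.Re z.
Proof. by case: z. Qed.

Lemma cImN z : complex.Im (- z) = - complex.Im z.
Proof. by case: z. Qed.

Lemma cReM z w : complex.Re (z * w) =
  complex.Re z * complex.Re w - complex.Im z * complex.Im w.
Proof. by case: z; case: w. Qed.

Lemma cImM z w : complex.Im (z * w) =
  complex.Re z * complex.Im w + complex.Im z * complex.Re w.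
Proof. by case: z => a b; case: w. Qed.

Lemma cReC z : complex.Re z^*%C = complex.Re z.
Proof. by case: z. Qed.

Lemma cImC z : complex.Im z^*%C = - complex.Im z.
Proof. by case: z. Qed.

Definition ReImE := (cReD, cImD, cReN, cImN, cReM, cImM, cReC, cImC).

Lemma complexP z w : complex.Re z = complex.Re w ->
  complex.Im z = complex.Im w -> z = w.
Proof. by case: z => a b; case: w => a' b' /= -> ->. Qed.

Lemma sqmod_ge0 z : 0 <= sqmod z.
Proof. by rewrite /sqmod addr_ge0 ?sqr_ge0. Qed.

Lemma sqmod0 : sqmod (0 : R[i]) = 0.
Proof. by rewrite /sqmod /= expr0n addr0. Qed.

Lemma sqmodM z w : sqmod (z * w) = sqmod z * sqmod w.
Proof. by rewrite /sqmod !ReImE; ring. Qed.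

Lemma sqmodC z : sqmod z^*%C = sqmod z.
Proof. by rewrite /sqmod !ReImE; ring. Qed.

Lemma sqmodN z : sqmod (- z) = sqmod z.
Proof. by rewrite /sqmod !ReImE; ring. Qed.

Lemma sqmod_real (x : R) : sqmod x%:C = x ^+ 2.
Proof. by rewrite /sqmod /= expr0n addr0. Qed.

Lemma sqmod_parallelogram z w :
  sqmod (z + w) + sqmod (z - w) = 2 * sqmod z + 2 * sqmod w.
Proof. by rewrite /sqmod !ReImE; ring. Qed.

Lemma sqmodD_le z w : sqmod (z + w) <= 2 * sqmod z + 2 * sqmod w.
Proof. by rewrite -sqmod_parallelogram lerDl sqmod_ge0. Qed.

Lemma mulC_conj z : z * z^*%C = (sqmod z)%:C.
Proof. by apply: complexP; rewrite /sqmod !ReImE /=; ring. Qed.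

(** A crude form of 2|zw| <= |z|^2 + |w|^2. The lost factor is harmless, since the bound only serves
    to dominate products by integrable or summable families. *)
Lemma normRe_le z w : `|complex.Re (z * w)| <= sqmod z + sqmod w.
Proof.
rewrite cReM ler_norml /sqmod; apply/andP.
have := sqr_ge0 (complex.Re z + complex.Re w).
have := sqr_ge0 (complex.Im z - complex.Im w).
have := sqr_ge0 (complex.Re z - complex.Re w).
have := sqr_ge0 (complex.Im z + complex.Im w).
by move=> h1 h2 h3 h4; split; nra.
Qed.

Lemma normIm_le z w : `|complex.Im (z * w)| <= sqmod z + sqmod w.
Proof.
rewrite cImM ler_norml /sqmod; apply/andP.
have := sqr_ge0 (complex.Re z + complex.Im w).
have := sqr_ge0 (complex.Im z - complex.Re w).
have := sqr_ge0 (complex.Re z - complex.Im w).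
have := sqr_ge0 (complex.Im z + complex.Re w).
by move=> h1 h2 h3 h4; split; nra.
Qed.

End complex_algebra.

(** * Square-integrable complex functions *)

Section L2_theory.
Context {R : realType}.
Local Notation mu := (@lebesgue_measure R).
Implicit Types (D : set R) (f g : R -> R[i]).

Lemma cmeasurableD D f g : cmeasurable D f -> cmeasurable D g ->
  cmeasurable D (f \+ g).
Proof.
move=> [f1 f2] [g1 g2]; split.
- rewrite (_ : (fun _ => _) = (fun x => complex.Re (f x) + complex.Re (g x))).
    exact: measurable_funD.
  by apply/funext => x /=; rewrite cReD.
- rewrite (_ : (fun _ => _) = (fun x => complex.Im (f x) + complex.Im (g x))).
    exact: measurable_funD.
  by apply/funext => x /=; rewrite cImD.
Qed.

Lemma cmeasurableM D f g : cmeasurable D f -> cmeasurable D g ->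
  cmeasurable D (fun x => f x * g x).
Proof.
move=> [f1 f2] [g1 g2]; split.
- rewrite (_ : (fun _ => _) = fun x =>
    complex.Re (f x) * complex.Re (g x) - complex.Im (f x) * complex.Im (g x)).
    by apply: measurable_funB; exact: measurable_funM.
  by apply/funext => x /=; rewrite cReM.
- rewrite (_ : (fun _ => _) = fun x =>
    complex.Re (f x) * complex.Im (g x) + complex.Im (f x) * complex.Re (g x)).
    by apply: measurable_funD; exact: measurable_funM.
  by apply/funext => x /=; rewrite cImM.
Qed.

Lemma cmeasurableC D f : cmeasurable D f -> cmeasurable D (fun x => (f x)^*%C).
Proof.
move=> [f1 f2]; split; first by under eq_fun do rewrite cReC.
by under eq_fun do rewrite cImC; exact: measurable_funN.
Qed.

Lemma cmeasurable_real D (u : R -> R) : measurable_fun D u ->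
  cmeasurable D (fun x => (u x)%:C).
Proof. by move=> mu_; split => //=; exact: measurable_cst. Qed.

Lemma cmeasurable_cst D z : cmeasurable D (fun=> z).
Proof. by split; exact: measurable_cst. Qed.

Lemma measurable_sqmod D f : cmeasurable D f ->
  measurable_fun D (fun x => sqmod (f x)).
Proof. by move=> [f1 f2]; apply: measurable_funD; exact: measurable_funX. Qed.

Lemma measurable_sqmodE D f : cmeasurable D f ->
  measurable_fun D (fun x => (sqmod (f x))%:E).
Proof. by move=> mf; apply/measurable_EFinP; exact: measurable_sqmod. Qed.

Lemma L2norm_ge0 D f : (0 <= L2norm_sq D f)%E.
Proof. by apply: integral_ge0 => x _; rewrite lee_fin sqmod_ge0. Qed.

(** A real value allows subtraction in the polarization and parallelogram identities. It is the
    squared norm on [L2 D]; elsewhere [fine] may turn an infinite norm into 0. *)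
Definition L2n D f : R := fine (L2norm_sq D f).

Lemma L2nE D f : L2 D f -> L2norm_sq D f = (L2n D f)%:E.
Proof. by move=> [_ h]; rewrite fineK// ge0_fin_numE// L2norm_ge0. Qed.

Lemma L2n_ge0 D f : 0 <= L2n D f.
Proof. by apply: fine_ge0; exact: L2norm_ge0. Qed.

Definition cintegrable D f :=
  mu.-integrable D (EFin \o (fun x => complex.Re (f x))) /\
  mu.-integrable D (EFin \o (fun x => complex.Im (f x))).

Section fixed_domain.
Variable D : set R.
Hypothesis mD : measurable D.

Lemma L2_integrable f : L2 D f -> mu.-integrable D (fun x => (sqmod (f x))%:E).
Proof.
move=> [mf hf]; apply/integrableP; split; first exact: measurable_sqmodE.
under eq_integral do rewrite gee0_abs ?lee_fin ?sqmod_ge0//.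
exact: hf.
Qed.

Lemma L2n_Rintegral f : L2n D f = Rintegral mu D (fun x => sqmod (f x)).
Proof. by []. Qed.

Lemma L2_mul_integrable f g : L2 D f -> L2 D g -> cintegrable D (fun x => f x * g x).
Proof.
move=> hf hg.
have ih : mu.-integrable D (fun x => (sqmod (f x) + sqmod (g x))%:E).
  have := integrableD (mu := mu) mD (L2_integrable hf) (L2_integrable hg).
  exact: eq_integrable.
have [m1 m2] := cmeasurableM hf.1 hg.1.
split; apply: (le_integrable (mu := mu) mD _ _ ih) => //.
- exact/measurable_EFinP.
- move=> x _ /=; rewrite lee_fin [leRHS]ger0_norm ?(addr_ge0 (sqmod_ge0 _) (sqmod_ge0 _))//.
  exact: normRe_le.
- exact/measurable_EFinP.
- move=> x _ /=; rewrite lee_fin [leRHS]ger0_norm ?(addr_ge0 (sqmod_ge0 _) (sqmod_ge0 _))//.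
  exact: normIm_le.
Qed.

Lemma L2_conj f : L2 D f -> L2 D (fun x => (f x)^*%C).
Proof.
move=> [mf hf]; split; first exact: cmeasurableC.
by rewrite /L2norm_sq; under eq_integral do rewrite sqmodC.
Qed.

Lemma L2D f g : L2 D f -> L2 D g -> L2 D (f \+ g).
Proof.
move=> hf hg; split; first by apply: cmeasurableD; [exact: hf.1|exact: hg.1].
have ih : mu.-integrable D (fun x => (2 * sqmod (f x) + 2 * sqmod (g x))%:E).
  have := integrableD (mu := mu) mD (integrableZl (mu := mu) mD 2 (L2_integrable hf))
    (integrableZl (mu := mu) mD 2 (L2_integrable hg)).
  exact: eq_integrable.
have m : measurable_fun D (fun x => (sqmod ((f \+ g) x))%:E).
  apply: measurable_sqmodE; apply: cmeasurableD; [exact: hf.1|exact: hg.1].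
have /integrableP[_] : mu.-integrable D (fun x => (sqmod ((f \+ g) x))%:E).
  apply: (le_integrable (mu := mu) mD m _ ih) => x _ /=.
  rewrite lee_fin !ger0_norm ?sqmod_ge0 ?sqmodD_le//.
  by rewrite addr_ge0// mulr_ge0 ?sqmod_ge0.
by under eq_integral do rewrite gee0_abs ?lee_fin ?sqmod_ge0//.
Qed.

Lemma L2Z z f : L2 D f -> L2 D (fun x => z * f x).
Proof.
move=> hf; split.
  by apply: cmeasurableM; [exact: cmeasurable_cst|exact: hf.1].
rewrite /L2norm_sq; under eq_integral do rewrite sqmodM EFinM.
rewrite integralZl//; last exact: L2_integrable.
by rewrite -/(L2norm_sq D f) L2nE// -EFinM ltry.
Qed.

Lemma L2N f : L2 D f -> L2 D (\- f).
Proof.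
move=> hf; have := L2Z (-1) hf.
by congr L2; apply/funext => x; rewrite mulN1r.
Qed.

Lemma L2B f g : L2 D f -> L2 D g -> L2 D (f \- g).
Proof. by move=> hf hg; exact: (L2D hf (L2N hg)). Qed.

Lemma L2nZ z f : L2 D f -> L2n D (fun x => z * f x) = sqmod z * L2n D f.
Proof.
move=> hf; rewrite !L2n_Rintegral.
under eq_Rintegral do rewrite sqmodM.
by rewrite RintegralZl//; exact: L2_integrable.
Qed.

Lemma cintegralD f g : cintegrable D f -> cintegrable D g ->
  cintegral D (fun x => f x + g x) = cintegral D f + cintegral D g.
Proof.
move=> [f1 f2] [g1 g2]; apply: complexP; rewrite /cintegral ?cReD ?cImD /=.
- by under eq_Rintegral do rewrite cReD; rewrite RintegralD.
- by under eq_Rintegral do rewrite cImD; rewrite RintegralD.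
Qed.

Lemma integrableZ_EFin (k : R) (u : R -> R) : mu.-integrable D (EFin \o u) ->
  mu.-integrable D (EFin \o (fun x => k * u x)).
Proof.
move=> iu; have := integrableZl (mu := mu) mD k iu.
by apply: eq_integrable => // x _ /=; rewrite EFinM.
Qed.

Lemma cintegralZ z f : cintegrable D f ->
  cintegral D (fun x => z * f x) = z * cintegral D f.
Proof.
move=> [f1 f2]; apply: complexP; rewrite /cintegral ?cReM ?cImM /=.
- under eq_Rintegral do rewrite cReM.
  by rewrite RintegralB ?RintegralZl//; exact: integrableZ_EFin.
- under eq_Rintegral do rewrite cImM.
  by rewrite RintegralD ?RintegralZl//; exact: integrableZ_EFin.
Qed.

Lemma L2inner_Zr f g z : L2 D f -> L2 D g ->
  L2inner D f (fun x => z * g x) = z^*%C * L2inner D f g.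
Proof.
move=> hf hg; rewrite /L2inner -cintegralZ//.
  congr cintegral; apply/funext => x; rewrite rmorphM/= mulrCA//.
by apply: L2_mul_integrable => //; exact: L2_conj.
Qed.

Lemma L2nB_expand f g : L2 D f -> L2 D g ->
  L2n D (f \- g) = L2n D f + L2n D g - 2 * complex.Re (L2inner D f g).
Proof.
move=> hf hg.
have [i1 _] := L2_mul_integrable hf (L2_conj hg).
rewrite !L2n_Rintegral /L2inner /cintegral /= -RintegralZl// -RintegralD//.
- rewrite -RintegralB//.
  + by apply: eq_Rintegral => x _; rewrite /sqmod !ReImE; ring.
  + have := integrableD (mu := mu) mD (L2_integrable hf) (L2_integrable hg).
    by apply: eq_integrable.
  + exact: integrableZ_EFin.
- exact: L2_integrable.
- exact: L2_integrable.
Qed.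

Lemma L2n_parallelogram f g : L2 D f -> L2 D g ->
  L2n D (f \+ g) + L2n D (f \- g) = 2 * L2n D f + 2 * L2n D g.
Proof.
move=> hf hg.
rewrite !L2n_Rintegral -RintegralD//; first last.
- exact: L2_integrable (L2B hf hg).
- exact: L2_integrable (L2D hf hg).
rewrite -!RintegralZl// -?RintegralD//; try exact: L2_integrable.
- by apply: eq_Rintegral => x _ /=; rewrite sqmod_parallelogram.
- exact/integrableZ_EFin/L2_integrable.
- exact/integrableZ_EFin/L2_integrable.
Qed.

End fixed_domain.
End L2_theory.

(** * Fourier series on a period *)

Section character.
Context {R : realType}.

Definition expi (t : R) : R[i] := cos t +i* sin t.

Lemma expiD s t : expi (s + t) = expi s * expi t.
Proof. by apply: complexP; rewrite ?cReM ?cImM /= ?cosD ?sinD//; ring. Qed.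

Lemma expi0 : expi 0 = 1.
Proof. by apply: complexP; rewrite /= ?cos0 ?sin0. Qed.

Lemma expi_conj t : (expi t)^*%C = expi (- t).
Proof. by apply: complexP; rewrite ?cReC ?cImC /= ?cosN ?sinN. Qed.

Lemma sqmod_expi t : sqmod (expi t) = 1.
Proof. by rewrite /sqmod /= cos2Dsin2. Qed.

Lemma cos_2pi_int (m : int) : cos (2 * pi * m%:~R) = 1 :> R.
Proof.
have H (n : nat) : cos (2 * pi * n%:R) = 1 :> R.
  elim: n => [|n ih]; first by rewrite mulr0 cos0.
  rewrite (_ : 2 * pi * n.+1%:R = 2 * pi * n%:R + pi *+ 2); first by rewrite cosD2pi.
  by rewrite -natr1 -mulr_natl; ring.
case: m => n; first exact: H.
by rewrite NegzE intrN mulrN cosN; exact: H.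
Qed.

Lemma sin_2pi_int (m : int) : sin (2 * pi * m%:~R) = 0 :> R.
Proof.
have := cos2Dsin2 (2 * pi * m%:~R : R).
rewrite cos_2pi_int expr1n => /eqP; rewrite -subr_eq0 addrAC subrr add0r.
by rewrite sqrf_eq0 => /eqP.
Qed.

Lemma expi_2pi_int (m : int) : expi (2 * pi * m%:~R) = 1.
Proof. by apply: complexP; rewrite /= ?cos_2pi_int ?sin_2pi_int. Qed.

Lemma measurable_cos D : measurable_fun D (@cos R).
Proof.
by apply: measurable_funTS; apply: continuous_measurable_fun; exact: continuous_cos.
Qed.

Lemma measurable_sin D : measurable_fun D (@sin R).
Proof.
by apply: measurable_funTS; apply: continuous_measurable_fun; exact: continuous_sin.
Qed.

Lemma cmeasurable_expi D (w : R) : cmeasurable D (fun x => expi (w * x)).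
Proof.
split => /=; apply: measurable_funTS.
  apply: (@measurableT_comp _ _ _ _ _ _ cos); first exact: measurable_cos.
  exact: mulrl_measurable.
apply: (@measurableT_comp _ _ _ _ _ _ sin); first exact: measurable_sin.
exact: mulrl_measurable.
Qed.

Lemma integral_cos_sin (w s t : R) : w != 0 -> s < t ->
  (\int[lebesgue_measure]_(x in `[s, t]) (cos (w * x))%:E =
    (sin (w * t) / w - sin (w * s) / w)%:E)%E /\
  (\int[lebesgue_measure]_(x in `[s, t]) (sin (w * x))%:E =
    (- cos (w * t) / w + cos (w * s) / w)%:E)%E.
Proof.
move=> w0 st.
have dl (x : R) : is_derive x 1 ( *%R w) w.
  by rewrite -[X in is_derive _ _ _ X]mulr1; exact: is_deriveZ.
have dc (x : R) : is_derive x 1 (fun x => sin (w * x) / w) (cos (w * x)).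
  have := @is_derive1_comp _ sin ( *%R w) x _ _ (is_derive_sin _) (dl x).
  move=> /(is_deriveZ w^-1); rewrite /GRing.scale /=.
  rewrite (mulrC _ w) mulrA mulVf// mul1r => h.
  rewrite (_ : (fun _ => _) = w^-1 *: (sin \o *%R w)); first exact: h.
  by apply/funext => y; rewrite /= mulrC.
have ds (x : R) : is_derive x 1 (fun x => - cos (w * x) / w) (sin (w * x)).
  have := @is_derive1_comp _ cos ( *%R w) x _ _ (is_derive_cos _) (dl x).
  move=> /(is_deriveZ (- w^-1)); rewrite /GRing.scale /=.
  rewrite (_ : - w^-1 * (- sin (w * x) * w) = sin (w * x)) => [h|]; last by field.
  rewrite (_ : (fun _ => _) = (- w^-1) *: (cos \o *%R w)); first exact: h.
  by apply/funext => y; rewrite -[RHS]/(- w^-1 * cos (w * y)); ring.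
have dLR (F f : R -> R) : (forall x : R, is_derive x 1 F (f x)) ->
    derivable_oo_LRcontinuous F s t.
  move=> h; have cF x : {for x, continuous F}.
    apply: differentiable_continuous; apply/derivable1_diffP.
    by case: (h x).
  split; first by move=> x _; by case: (h x).
  - by apply: cvg_at_right_filter; exact: cF.
  - by apply: cvg_at_left_filter; exact: cF.
have lin : continuous ( *%R w : R -> R).
  exact: mulrl_continuous.
split.
- rewrite (continuous_FTC2 (F := fun x => sin (w * x) / w) st) ?EFinB//.
  + apply: continuous_subspaceT => x; apply: continuous_comp; first exact: lin.
    exact: continuous_cos.
  + exact: dLR dc.
  + by move=> x _; rewrite derive1E; case: (dc x).
- rewrite (continuous_FTC2 (F := fun x => - cos (w * x) / w) st).
  + by rewrite -EFinB [X in _ - X]mulNr opprK.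
  + apply: continuous_subspaceT => x; apply: continuous_comp; first exact: lin.
    exact: continuous_sin.
  + exact: dLR ds.
  + by move=> x _; rewrite derive1E; case: (ds x).
Qed.
End character.

(** * Nonnegative sums over Z *)

Section int_series.
Context {R : realType}.

(** The enumeration 0, -1, 1, -2, ... of Z. It turns sums over Z into series, for which
    measurability and monotone convergence are available. *)
Definition nu (n : nat) : int := if odd n then Negz n./2 else Posz n./2.

Lemma nu_bij : set_bij [set: nat] [set: int] nu.
Proof.
split=> // [m n _ _|[n|n] _].
- move=> h; rewrite -[m]odd_double_half -[n]odd_double_half; move: h.
  by rewrite /nu; case: (odd m); case: (odd n) => // -[->].
- by exists n.*2 => //; rewrite /nu odd_double doubleK.
- by exists n.*2.+1 => //; rewrite /nu /= odd_double uphalf_double.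
Qed.

Lemma esum_nu (a : int -> \bar R) : (forall i, 0 <= a i)%E ->
  (\esum_(i in [set: int]) a i = \sum_(k <oo) a (nu k))%E.
Proof. by move=> a0; rewrite nneseries_esumT// (reindex_esum _ _ _ _ nu_bij). Qed.

Lemma esumZl (r : R) (a : int -> \bar R) : 0 <= r -> (forall i, 0 <= a i)%E ->
  (\esum_(i in [set: int]) (r%:E * a i) = r%:E * \esum_(i in [set: int]) a i)%E.
Proof.
move=> r0 a0; rewrite !esum_nu//; last by move=> i; rewrite mule_ge0.
by rewrite nneseriesZl.
Qed.

Lemma esum_ge_term (w : int -> \bar R) n : (forall k, 0 <= w k)%E ->
  (w n <= \esum_(k in [set: int]) w k)%E.
Proof.
move=> w0; apply: esum_ge; exists [set n]; first by split.
by rewrite fsbig_set1.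
Qed.

Lemma measurable_esum d (T : measurableType d) (D : set T)
    (h : int -> T -> \bar R) :
  (forall k x, 0 <= h k x)%E -> (forall k, measurable_fun D (h k)) ->
  measurable_fun D (fun x => \esum_(k in [set: int]) h k x)%E.
Proof.
move=> h0 mh; under eq_fun do rewrite esum_nu//.
by apply: ge0_emeasurable_sum.
Qed.

Lemma integral_esum d (T : measurableType d) (mu : {measure set T -> \bar R})
    (D : set T) (h : int -> T -> \bar R) : measurable D ->
  (forall k x, 0 <= h k x)%E -> (forall k, measurable_fun D (h k)) ->
  (\int[mu]_(x in D) (\esum_(k in [set: int]) h k x) =
   \esum_(k in [set: int]) (\int[mu]_(x in D) h k x))%E.
Proof.
move=> mD h0 mh; under eq_integral do rewrite esum_nu//.
rewrite integral_nneseries// esum_nu// => k.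
by apply: integral_ge0.
Qed.

End int_series.

(** * Bessel's inequality and the class of functions satisfying Parseval *)

Section Fourier.
Context {R : realType}.
Variables b c : R.
Hypotheses (c0 : 0 < c) (bc : b * c = 1).
Local Notation mu := (@lebesgue_measure R).
Local Notation I := `[0, c]%classic.
Implicit Types (F G : R -> R[i]) (m : int).

Definition chi m (x : R) : R[i] := expi (2 * pi * (m%:~R * b) * x).

(** The Fourier coefficient without the factor 1/c; this is why Bessel and Parseval below carry a
    factor [c]. *)
Definition coef m F : R[i] := L2inner I F (chi m).

Let mI : measurable I. Proof. exact: measurable_itv. Qed.

Lemma measure_period : mu I = c%:E.
Proof. by rewrite lebesgue_measure_itv /= lte_fin c0 oppr0 addr0. Qed.

Lemma chiM_conj m l x : chi m x * (chi l x)^*%C = chi (m - l) x.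
Proof. by rewrite /chi expi_conj -expiD; congr expi; rewrite intrB; ring. Qed.

Lemma chi_period m (k : int) x : chi m (x - k%:~R * c) = chi m x.
Proof.
rewrite /chi (_ : _ * (x - _) = 2 * pi * (m%:~R * b) * x + 2 * pi * (- (m * k))%:~R).
  by rewrite expiD expi_2pi_int mulr1.
rewrite intrN intrM mulrBr; congr (_ + _).
rewrite (_ : _ * (k%:~R * c) = 2 * pi * (m%:~R * k%:~R) * (b * c)); last by ring.
by rewrite bc; ring.
Qed.

Lemma cmeasurable_chi m D : cmeasurable D (chi m).
Proof. exact: cmeasurable_expi. Qed.

Lemma L2_bounded_mul D F (p : R -> R[i]) (M : R) : measurable D ->
  cmeasurable D p -> (forall x, D x -> sqmod (p x) <= M) -> L2 D F ->
  L2 D (fun x => p x * F x).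
Proof.
move=> mD mp pM hF; split; first by apply: cmeasurableM => //; exact: hF.1.
have ih := integrableZl (mu := mu) mD M (L2_integrable hF).
have : mu.-integrable D (fun x => (sqmod (p x * F x))%:E).
  apply: (le_integrable (mu := mu) mD _ _ ih).
    by apply: measurable_sqmodE; apply: cmeasurableM => //; exact: hF.1.
  move=> x Dx /=; rewrite lee_fin sqmodM normrM [leRHS]normrM.
  rewrite ler_wpM2r// ger0_norm ?sqmod_ge0//.
  by apply: (le_trans (pM _ Dx)); exact: ler_norm.
move=> /integrableP[_].
by under eq_integral do rewrite gee0_abs ?lee_fin ?sqmod_ge0//.
Qed.

Lemma L2_1 : L2 I (fun=> 1).
Proof.
split; first exact: cmeasurable_cst.
rewrite /L2norm_sq integral_cst//= measure_period.
by rewrite -EFinM ltry.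
Qed.

Lemma L2_chi m : L2 I (chi m).
Proof.
have := @L2_bounded_mul I (fun=> 1) (chi m) 1 mI (cmeasurable_chi m I).
rewrite (_ : (fun x => chi m x * 1) = chi m); last first.
  by apply/funext => x; rewrite mulr1.
by apply => //; [move=> x _; rewrite sqmod_expi|exact: L2_1].
Qed.

Lemma coef_integrable m F : L2 I F ->
  cintegrable I (fun x => F x * (chi m x)^*%C).
Proof. by move=> hF; apply: L2_mul_integrable => //; exact/L2_conj/L2_chi. Qed.

Lemma coefD m F G : L2 I F -> L2 I G -> coef m (F \+ G) = coef m F + coef m G.
Proof.
move=> hF hG; rewrite /coef /L2inner -cintegralD//; try exact: coef_integrable.
by congr cintegral; apply/funext => x /=; rewrite mulrDl.
Qed.

Lemma coefZ m z F : L2 I F -> coef m (fun x => z * F x) = z * coef m F.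
Proof.
move=> hF; rewrite /coef /L2inner -cintegralZ//; last exact: coef_integrable.
by congr cintegral; apply/funext => x /=; rewrite mulrA.
Qed.

Lemma coefB m F G : L2 I F -> L2 I G -> coef m (F \- G) = coef m F - coef m G.
Proof.
move=> hF hG.
rewrite (_ : F \- G = F \+ (fun x => -1 * G x)); last first.
  by apply/funext => x /=; rewrite mulN1r.
by rewrite coefD ?coefZ ?mulN1r//; exact: L2Z.
Qed.

Lemma coef_chi m l : coef l (chi m) = if m == l then c%:C else 0.
Proof.
rewrite /coef /L2inner; under [X in cintegral _ X]eq_fun do rewrite chiM_conj.
have [->|ml] := eqVneq m l.
  apply: complexP; rewrite /cintegral /=.
    rewrite (@eq_Rintegral _ _ _ mu I (cst 1)) ?Rintegral_cst//=.
      by rewrite mul1r measure_period.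
    by move=> x _; rewrite /chi /= subrr mul0r mulr0 mul0r cos0.
  rewrite (@eq_Rintegral _ _ _ mu I (cst 0)) ?Rintegral_cst//= ?mul0r//.
  by move=> x _; rewrite /chi /= subrr mul0r mulr0 mul0r sin0.
have b0 : b != 0 by apply: contra_eq_neq bc => ->; rewrite mul0r eq_sym oner_eq0.
pose w := 2 * pi * ((m - l)%:~R * b) : R.
have w0 : w != 0.
  rewrite /w !mulf_neq0// ?intr_eq0 ?subr_eq0//.
  by rewrite gt_eqF// pi_gt0.
have wc : w * c = 2 * pi * (m - l)%:~R.
  by rewrite /w -!mulrA bc mulr1.
have [ic is_] := integral_cos_sin w0 c0.
apply: complexP; rewrite /cintegral /= /Rintegral -/w.
  by rewrite ic wc sin_2pi_int mulr0 sin0 mul0r subrr.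
by rewrite is_ wc cos_2pi_int mulr0 cos0 mulNr addNr.
Qed.

Lemma L2n_chi m : L2n I (chi m) = c.
Proof.
rewrite /L2n /L2norm_sq; under eq_integral do rewrite sqmod_expi.
by rewrite integral_cst//= measure_period mul1e.
Qed.

(** Subtracting from [F] its projection on [chi m] leaves the other coefficients unchanged and
    lowers [c * L2n I F] by exactly [sqmod (coef m F)], so induction on the set of frequencies
    applies. *)
Lemma bessel_finite (s : seq int) F : uniq s -> L2 I F ->
  \sum_(m <- s) sqmod (coef m F) <= c * L2n I F.
Proof.
elim: s F => [|m s ih] F; first by rewrite big_nil mulr_ge0 ?L2n_ge0 ?ltW.
move=> /= /andP[ms us] hF; rewrite big_cons.
pose z := (c^-1)%:C * coef m F.
have hz := L2Z mI z (L2_chi m).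
have hG := L2B mI hF hz.
have := ih _ us hG.
rewrite (eq_big_seq (fun l => sqmod (coef l F))); last first.
  move=> l ls; rewrite coefB// coefZ ?coef_chi; last exact: L2_chi.
  case: eqVneq => [ml|_]; first by move: ms; rewrite ml ls.
  by rewrite mulr0 subr0.
rewrite L2nB_expand// L2nZ; [|exact: mI|exact: L2_chi].
rewrite L2n_chi L2inner_Zr//; last exact: L2_chi.
rewrite -/(coef m F) /z sqmodM sqmod_real.
have -> : complex.Re (((c^-1)%:C * coef m F)^*%C * coef m F) = c^-1 * sqmod (coef m F).
  by rewrite /sqmod !ReImE /=; ring.
have cn0 : c != 0 by rewrite gt_eqF.
have -> : c * (L2n I F + c^-1 ^+ 2 * sqmod (coef m F) * c -
   2 * (c^-1 * sqmod (coef m F))) = c * L2n I F - sqmod (coef m F) by field.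
by rewrite lerBrDr addrC.
Qed.

Definition energy F : \bar R := (\esum_(m in [set: int]) (sqmod (coef m F))%:E)%E.

Lemma bessel_le F : L2 I F -> (energy F <= (c * L2n I F)%:E)%E.
Proof.
move=> hF; apply: ge_ereal_sup => _ [X [finX _] <-].
rewrite fsbig_finite//= sumEFin lee_fin; apply: bessel_finite => //.
exact: fset_uniq.
Qed.

Lemma energy_ge0 F : (0 <= energy F)%E.
Proof. by apply: esum_ge0 => m _; rewrite lee_fin sqmod_ge0. Qed.

Definition parseval F := L2 I F /\ energy F = (c * L2n I F)%:E.

Lemma energyDB F G : L2 I F -> L2 I G ->
  (energy (F \+ G)%R + energy (F \- G)%R = 2%:E * energy F + 2%:E * energy G)%E.
Proof.
move=> hF hG.
have n0 H m : (0 <= (sqmod (coef m H))%:E)%E by rewrite lee_fin sqmod_ge0.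
have two (H : R -> R[i]) : (2%:E * energy H = energy H + energy H)%E.
  by rewrite (_ : 2%:E = 1%:E + 1%:E)%E// ge0_muleDl ?lee_fin// mul1e.
rewrite !two /energy -!esumD//; last 2 first.
- by move=> m _; rewrite adde_ge0.
- by move=> m _; rewrite adde_ge0.
apply: eq_esum => m _; rewrite coefD// coefB// -!EFinD; congr EFin.
by rewrite sqmod_parallelogram; ring.
Qed.

Lemma energyZ z F : L2 I F ->
  energy (fun x => z * F x) = ((sqmod z)%:E * energy F)%E.
Proof.
move=> hF; rewrite /energy.
under eq_esum do rewrite coefZ// sqmodM EFinM.
by rewrite esumZl ?sqmod_ge0// => m; rewrite lee_fin sqmod_ge0.
Qed.

(** Energy and c times the squared norm both obey the parallelogram law. The Bessel inequalities for
    F + G and F - G thus add up to an equality, so each of them is one. *)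
Lemma parsevalD F G : parseval F -> parseval G -> parseval (F \+ G).
Proof.
move=> [hF eF] [hG eG]; have hD := L2D mI hF hG; split => //.
apply/eqP; rewrite eq_le bessel_le//=.
have hB := L2B mI hF hG.
have := energyDB hF hG; rewrite eF eG.
have := bessel_le hB; have := bessel_le hD.
have := energy_ge0 (F \+ G); have := energy_ge0 (F \- G).
have := L2n_parallelogram mI hF hG.
case: (energy (F \+ G)) => [u| |]//; case: (energy (F \- G)) => [v| |]//.
rewrite !lee_fin => h _ _ h1 h2; rewrite -!EFinM -!EFinD => -[h3].
by move: (congr1 (fun t => c * t) h); rewrite !mulrDr; lra.
Qed.

Lemma parsevalZ z F : parseval F -> parseval (fun x => z * F x).
Proof.
move=> [hF eF]; split; first exact: L2Z.
rewrite energyZ// eF -EFinM L2nZ//.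
by rewrite mulrCA.
Qed.

(** The parallelogram law is applied to G and F - G, whose sum is F and whose difference is 2G - F.
    Bessel for 2G - F and Parseval for G give energy F >= c |F|^2 - 2c |F - G|^2. *)
Lemma parseval_limit F : L2 I F ->
  (forall e : R, 0 < e -> exists2 G, parseval G & L2n I (F \- G) < e) ->
  parseval F.
Proof.
move=> hF h; split => //; apply/eqP; rewrite eq_le bessel_le//=.
apply/lee_addgt0Pr => e e0.
(* The loss in the lower bound is 2c times the squared distance from F to G. *)
have e'0 : 0 < e / (2 * c) by rewrite divr_gt0// mulr_gt0.
have [G [hG eG] Ge] := h _ e'0.
have hB := L2B mI hF hG; have hB' := L2B mI hG hB.
have FE : G \+ (F \- G) = F by apply/funext => x /=; rewrite addrC subrK.
have := energyDB hG hB; rewrite FE eG.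
have := bessel_le hB'; have := energy_ge0 (F \- G).
have := L2n_parallelogram mI hG hB; rewrite FE.
have := bessel_le hB; have := bessel_le hF.
have := energy_ge0 F; have := energy_ge0 (G \- (F \- G)).
case: (energy (G \- (F \- G))) => [u| |]//; case: (energy F) => [v| |]//.
case: (energy (F \- G)) => [w| |]//.
rewrite !lee_fin => _ v0 h1 h2 h3 w0 h4.
rewrite -!EFinM -!EFinD => -[h5].
have h6 : c * L2n I (F \- G) <= e / 2.
  have : c * L2n I (F \- G) <= c * (e / (2 * c)) by rewrite ler_pM2l// ltW.
  by rewrite (_ : c * (e / (2 * c)) = e / 2)//; field; rewrite gt_eqF.
move: (congr1 (fun t => c * t) h3); rewrite !mulrDr => h3'.
by lra.
Qed.

Lemma integral_dirichlet (m : int) :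
  Rintegral mu I (fun x => cos (2 * pi * (m%:~R * b) * x)) = c *+ (m == 0) /\
  Rintegral mu I (fun x => sin (2 * pi * (m%:~R * b) * x)) = 0.
Proof.
have := coef_chi m 0; rewrite /coef /L2inner.
under [X in cintegral _ X]eq_fun do rewrite chiM_conj subr0.
move=> h; have := congr1 (@complex.Im _) h; have := congr1 (@complex.Re _) h.
by rewrite /cintegral /= => -> ->; case: eqVneq.
Qed.

Lemma Rintegral_sum (A : set R) n (f : 'I_n -> R -> R) : measurable A ->
  (forall i, mu.-integrable A (EFin \o f i)) ->
  Rintegral mu A (fun x => \sum_i f i x) = \sum_i Rintegral mu A (f i).
Proof.
elim: n f => [|n ih] f mA fi.
  rewrite big_ord0; under eq_Rintegral do rewrite big_ord0.
  by rewrite Rintegral_cst// mul0r.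
rewrite big_ord_recl; under eq_Rintegral do rewrite big_ord_recl.
rewrite RintegralD// ?ih//.
have := integrable_sum (mu := mu) mA (I := 'I_n) (P := xpredT)
  (h := fun i x => (f (lift ord0 i) x)%:E) (enum 'I_n).
move=> /(_ (fun i _ => fi _)); apply: eq_integrable => // x _ /=.
by rewrite sumEFin big_enum.
Qed.

(* The square modulus of the Dirichlet sum, as a trigonometric polynomial. *)
Definition fejer (N : nat) (t : R) : R :=
  \sum_(j < N) \sum_(l < N) cos (2 * pi * ((j%:Z - l%:Z)%:~R * b) * t).

Lemma fejer_sqmod N t :
  fejer N t = sqmod (\sum_(j < N) expi (2 * pi * b * t) ^+ j).
Proof.
set z := expi _.
have zX k : z ^+ k = expi (2 * pi * (k%:R * b) * t).
  elim: k => [|k ih]; first by rewrite expr0 mul0r mulr0 mul0r expi0.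
  by rewrite exprS ih -expiD; congr expi; rewrite -natr1; ring.
have ReS (n : nat) (f : 'I_n -> R[i]) :
    complex.Re (\sum_i f i) = \sum_i complex.Re (f i).
  by apply: (big_morph (@complex.Re R)) => //; exact: cReD.
have -> w : sqmod w = complex.Re (w * w^*%C) :> R.
  by rewrite mulC_conj.
rewrite rmorph_sum mulr_suml ReS; apply: eq_bigr => j _.
rewrite mulr_sumr ReS; apply: eq_bigr => l _ /=.
rewrite !zX expi_conj -expiD /=; congr cos.
by rewrite intrB; ring.
Qed.

Lemma fejer_ge0 N t : 0 <= fejer N t.
Proof. by rewrite fejer_sqmod sqmod_ge0. Qed.

(** Multiplying the geometric sum by z - 1 leaves z^N - 1, whose squared modulus is at most 4
    whatever N is, while |z - 1|^2 is the factor on the left. *)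
Lemma fejer_le N t : (2 - 2 * cos (2 * pi * b * t)) * fejer N t <= 4.
Proof.
rewrite fejer_sqmod; set z := expi _.
have -> : 2 - 2 * cos (2 * pi * b * t) = sqmod (z - 1).
  rewrite /sqmod !ReImE /=.
  have := cos2Dsin2 (2 * pi * b * t); lra.
rewrite -sqmodM -subrX1.
apply: (le_trans (sqmodD_le _ _)); rewrite sqmodN.
have -> : sqmod (z ^+ N) = 1.
  elim: N => [|N ih]; first by rewrite expr0 /sqmod /=; ring.
  by rewrite exprS sqmodM ih sqmod_expi mulr1.
by rewrite (_ : sqmod 1 = 1); [lra|rewrite /sqmod /=; ring].
Qed.

(** The condition keeps [t] at distance at least [d] from 0, c and -c, where the kernel
    concentrates; the bound does not depend on [N]. *)
Lemma fejer_far N (d t : R) : 0 < d -> d <= c / 2 -> d <= `|t| <= c - d ->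
  fejer N t <= 4 / (2 - 2 * cos (2 * pi * b * d)).
Proof.
move=> d0 dc /andP[dt tc].
have b0 : 0 < b.
  by rewrite -(pmulr_lgt0 _ c0) bc.
have pi0 := @pi_gt0 R.
have k0 : 0 < 2 * pi * b by rewrite !mulr_gt0.
have kc : 2 * pi * b * c = pi *+ 2 by rewrite -mulrA bc mulr1 mulr_natl.
have ab : cos (2 * pi * b * t) = cos (2 * pi * b * `|t|).
  have [h|h] := lerP 0 t; first by rewrite ger0_norm.
  by rewrite ltr0_norm// mulrN cosN.
have dec x y : 0 <= x -> x <= y -> y <= pi -> cos y <= cos x :> R.
  move=> x0 xy yp; have [->//|yx] := eqVneq x y.
  rewrite ltW// ltr_cos ?lt_neqAle ?yx// in_itv/= ?x0 ?yp ?(le_trans x0 xy)//.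
  exact: le_trans xy yp.
have ct : cos (2 * pi * b * t) <= cos (2 * pi * b * d).
  rewrite ab; have [h|h] := leP (2 * pi * b * `|t|) pi.
    by apply: dec => //; [rewrite mulr_ge0// ltW|rewrite ler_pM2l].
  (* Past half a period the angle is replaced by 2 pi minus itself, which is at most pi and, because
     |t| <= c - d, at least the angle of d. *)
  rewrite -[leLHS]cosN -(cosD2pi (- _)).
  apply: dec; first by rewrite mulr_ge0// ltW.
    rewrite -kc addrC -mulrBr ler_pM2l//; lra.
  by rewrite mulr2n; lra.
have cd1 : cos (2 * pi * b * d) < 1.
  have kd0 : 0 < 2 * pi * b * d by exact: mulr_gt0.
  have : 2 * pi * b * d <= 2 * pi * b * (c / 2) by rewrite ler_pM2l.
  rewrite mulrA kc (_ : pi *+ 2 / 2 = pi) => [kd|]; last first.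
    by rewrite -[pi *+ 2]mulr_natr mulfK// pnatr_eq0.
  have h0 : (0 : R) \in `[0, pi] by rewrite in_itv/= lexx ltW.
  have h1 : 2 * pi * b * d \in `[0, pi] by rewrite in_itv/= kd ltW.
  by rewrite -[X in _ < X]cos0 (ltr_cos h0 h1).
rewrite ler_pdivlMr; last by lra.
apply: le_trans (fejer_le N t).
rewrite mulrC ler_wpM2r ?fejer_ge0//; lra.
Qed.

Lemma measure_itv_cc (s t : R) : s <= t -> mu `[s, t]%classic = (t - s)%:E.
Proof.
rewrite le_eqVlt => /predU1P[->|st]; rewrite lebesgue_measure_itv /= lte_fin.
  by rewrite ltxx subrr.
by rewrite st.
Qed.

Lemma Rintegral_indic_mul (D A : set R) (f : R -> R) : A `<=` D ->
  Rintegral mu D (fun x => \1_A x * f x) = Rintegral mu A f.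
Proof.
move=> /setIidr <-; rewrite Rintegral_mkcondr; apply: eq_Rintegral => x xD.
rewrite patchE indicE in_setI xD /=.
by case: ifPn => h; rewrite ?mul1r// mul0r.
Qed.

Lemma integrable_trig (s t w : R) :
  mu.-integrable `[s, t] (EFin \o (fun x => cos (w * x))) /\
  mu.-integrable `[s, t] (EFin \o (fun x => sin (w * x))).
Proof.
have mst : measurable `[s, t]%classic by exact: measurable_itv.
have fin : (mu `[s, t]%classic < +oo)%E.
  by rewrite lebesgue_measure_itv /=; case: ifP => _; rewrite -?EFinB ltry.
have [mc ms] := cmeasurable_expi `[s, t] w.
split; apply: measurable_bounded_integrable => //.
- exists 1; split => // y y1 x _ /=.
  by rewrite (le_trans (cos_max _))// ltW.
- exists 1; split => // y y1 x _ /=.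
  by rewrite (le_trans (sin_max _))// ltW.
Qed.

(** * Parseval for the indicator of an interval *)

Section fejer_interval.
Variables s t : R.
Hypotheses (s0 : 0 <= s) (st : s < t) (tc : t <= c).
Let A := `[s, t]%classic.
Let F (x : R) : R[i] := (\1_A x)%:C.
Let w (m : int) : R := 2 * pi * (m%:~R * b).
Let C m := Rintegral mu A (fun x => cos (w m * x)).
Let S m := Rintegral mu A (fun x => sin (w m * x)).

Let mA : measurable A. Proof. exact: measurable_itv. Qed.

Let AI : A `<=` I.
Proof.
move=> x; rewrite /A /= !in_itv/= => /andP[sx xt].
by rewrite (le_trans s0 sx) (le_trans xt tc).
Qed.

Lemma L2_indic_itv : L2 I F.
Proof.
have := @L2_bounded_mul I (fun=> 1) F 1 mI.
rewrite (_ : (fun x => F x * 1) = F); last by apply/funext => x; rewrite mulr1.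
apply; last exact: L2_1.
  apply: cmeasurable_real; apply: measurable_funTS; exact: measurable_indic.
by move=> x _; rewrite /F sqmod_real indicE; case: (x \in A); rewrite ?expr1n ?expr0n.
Qed.

Lemma L2n_indic_itv : L2n I F = t - s.
Proof.
rewrite L2n_Rintegral.
under eq_Rintegral do rewrite sqmod_real indicE -indicE expr2.
rewrite Rintegral_indic_mul//.
rewrite (@eq_Rintegral _ _ _ mu A (cst 1)); last first.
  by move=> x xA; rewrite xA.
rewrite Rintegral_cst//= mul1r measure_itv_cc ?(ltW st)//.
Qed.

Lemma coef_indic m : sqmod (coef m F) = C m ^+ 2 + S m ^+ 2.
Proof.
have -> : coef m F = C m -i* S m.
  rewrite /coef /L2inner /cintegral; congr (_ +i* _).
    under eq_Rintegral do rewrite cReM /F /= mul0r subr0.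
    by rewrite Rintegral_indic_mul.
  under eq_Rintegral do rewrite cImM /F /= mul0r addr0.
  rewrite Rintegral_indic_mul//.
  have := @RintegralZl _ _ _ mu A _ (-1) mA (integrable_trig s t (w m)).2.
  rewrite mulN1r => <-; apply: eq_Rintegral => x _.
  by rewrite mulN1r.
by rewrite /sqmod /= sqrrN.
Qed.

Section fejer_domain.
Variable B : set R.
Hypotheses (mB : measurable B)
  (iB : forall w, mu.-integrable B (EFin \o (fun x => cos (w * x))) /\
                  mu.-integrable B (EFin \o (fun x => sin (w * x)))).

Let iE m x : mu.-integrable B (EFin \o (fun y => cos (w m * (x - y)))).
Proof.
have := integrableD (mu := mu) mB
  (integrableZl (mu := mu) mB (cos (w m * x)) (iB (w m)).1)
  (integrableZl (mu := mu) mB (sin (w m * x)) (iB (w m)).2).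
apply: eq_integrable => // y _ /=.
by rewrite -!EFinM -EFinD mulrBr cosB.
Qed.

Lemma integrable_sumr n (f : 'I_n -> R -> R) :
  (forall i, mu.-integrable B (EFin \o f i)) ->
  mu.-integrable B (EFin \o (fun y => \sum_i f i y)).
Proof.
move=> fi; have := integrable_sum (mu := mu) mB (I := 'I_n) (P := xpredT)
  (h := fun i y => (f i y)%:E) (index_enum 'I_n).
move=> /(_ (fun i _ => fi _)); apply: eq_integrable => // y _ /=.
by rewrite sumEFin.
Qed.

Lemma integrable_fejer N x : mu.-integrable B (EFin \o (fun y => fejer N (x - y))).
Proof. by apply: integrable_sumr => j; apply: integrable_sumr => l; exact: iE. Qed.

(** The addition formula for the cosine separates x from y. The domain [B] is kept general because
    the kernel is integrated over the whole period and over the interval [A]. *)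
Lemma Rintegral_fejer N x :
  Rintegral mu B (fun y => fejer N (x - y)) =
  \sum_(j < N) \sum_(l < N)
    (cos (w (j%:Z - l%:Z) * x) * Rintegral mu B (fun y => cos (w (j%:Z - l%:Z) * y)) +
     sin (w (j%:Z - l%:Z) * x) * Rintegral mu B (fun y => sin (w (j%:Z - l%:Z) * y))).
Proof.
rewrite Rintegral_sum//; last first.
  by move=> j; apply: integrable_sumr => l; exact: iE.
apply: eq_bigr => j _; rewrite Rintegral_sum//; last by move=> l; exact: iE.
apply: eq_bigr => l _.
under eq_Rintegral do rewrite mulrBr cosB.
rewrite RintegralD ?RintegralZl//.
- exact: (iB _).2.
- exact: (iB _).1.
- exact/integrableZ_EFin/(iB _).1.
- exact/integrableZ_EFin/(iB _).2.
Qed.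

End fejer_domain.

(** Only the N diagonal terms j = l survive integration over a period, each contributing c. *)
Lemma Rintegral_fejer_period N x : Rintegral mu I (fun y => fejer N (x - y)) = N%:R * c.
Proof.
rewrite Rintegral_fejer; [|exact: mI|by move=> v; exact: integrable_trig].
rewrite (eq_bigr (fun=> c)); first by rewrite sumr_const card_ord mulr_natl.
move=> j _; rewrite (bigD1 j)//= big1 => [|l lj].
  have [-> ->] := integral_dirichlet (j%:Z - j%:Z).
  by rewrite subrr eqxx mulr1n /w mul0r mulr0 mul0r cos0 mul1r mulr0 !addr0.
have [-> ->] := integral_dirichlet (j%:Z - l%:Z).
have -> : (j%:Z - l%:Z == 0) = false.
  by apply/negbTE; rewrite subr_eq0 eqz_nat eq_sym.
by rewrite mulr0n !mulr0 addr0.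
Qed.

Let J N x := Rintegral mu A (fun y => fejer N (x - y)).

Let J_integrable N : mu.-integrable A (EFin \o J N).
Proof.
rewrite (_ : J N = fun x => \sum_(j < N) \sum_(l < N)
    (cos (w (j%:Z - l%:Z) * x) * C (j%:Z - l%:Z) +
     sin (w (j%:Z - l%:Z) * x) * S (j%:Z - l%:Z))).
  apply: integrable_sumr => // j; apply: integrable_sumr => // l.
  have := integrableD (mu := mu) mA
    (integrableZl (mu := mu) mA (C (j%:Z - l%:Z)) (integrable_trig s t (w (j%:Z - l%:Z))).1)
    (integrableZl (mu := mu) mA (S (j%:Z - l%:Z)) (integrable_trig s t (w (j%:Z - l%:Z))).2).
  apply: eq_integrable => // y _ /=.
  by rewrite -!EFinM -EFinD mulrC [X in _ + X]mulrC.
apply/funext => x; rewrite /J Rintegral_fejer//.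
by move=> v; exact: integrable_trig.
Qed.

(** Integrating the separated form once more over [A] squares the cosine and sine integrals, so the
    pair (j, l) contributes the squared modulus of the coefficient at j - l. *)
Lemma Rintegral_J N :
  Rintegral mu A (J N) = \sum_(j < N) \sum_(l < N) sqmod (coef (j%:Z - l%:Z) F).
Proof.
have iCS m : mu.-integrable A (EFin \o (fun x => C m * cos (w m * x))) /\
    mu.-integrable A (EFin \o (fun x => S m * sin (w m * x))).
  by have [? ?] := integrable_trig s t (w m); split; exact: integrableZ_EFin.
have iD m : mu.-integrable A (EFin \o (fun x => C m * cos (w m * x) + S m * sin (w m * x))).
  by have := integrableD (mu := mu) mA (iCS m).1 (iCS m).2; exact: eq_integrable.
rewrite (@eq_Rintegral _ _ _ mu A (fun x => \sum_(j < N) \sum_(l < N)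
    (C (j%:Z - l%:Z) * cos (w (j%:Z - l%:Z) * x) +
     S (j%:Z - l%:Z) * sin (w (j%:Z - l%:Z) * x)))); last first.
  move=> x _; rewrite /J Rintegral_fejer//; last by move=> v; exact: integrable_trig.
  by do 2 (apply: eq_bigr => ? _); rewrite mulrC [X in _ + X]mulrC.
rewrite Rintegral_sum//; last first.
  by move=> j; apply: integrable_sumr => // l; exact: iD.
apply: eq_bigr => j _; rewrite Rintegral_sum//.
apply: eq_bigr => l _; rewrite coef_indic.
have [i1 i2] := iCS (j%:Z - l%:Z).
have [i3 i4] := integrable_trig s t (w (j%:Z - l%:Z)).
by rewrite RintegralD ?RintegralZl.
Qed.

(** A point x at depth d inside [s, t] is d away from every y outside it; the upper bound c - d
    comes from [s, t] being contained in [0, c]. *)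
Lemma far_norm (d x y : R) : s + d <= x -> x <= t - d -> 0 <= y <= c ->
  0 < d -> y < s \/ t < y -> d <= `|x - y| <= c - d.
Proof.
move: s0 tc => h1 h2 h3 h4 /andP[h5 h6] d0 [h7|h7].
  have h : 0 <= x - y by lra.
  by rewrite (ger0_norm h); apply/andP; split; lra.
have h : x - y < 0 by lra.
by rewrite (ltr0_norm h); apply/andP; split; lra.
Qed.

Lemma energy_ge (r : seq int) : uniq r ->
  ((\sum_(m <- r) sqmod (coef m F))%:E <= energy F)%E.
Proof.
move=> ur; rewrite -sumEFin; apply: esum_ge.
exists [set` r] => //; first by split => //; exact: finite_seq.
by rewrite -fsbig_seq.
Qed.

(** Bessel gives one inequality. For the other, the double integral of the kernel over [A] is
    estimated twice: it is at most N times the energy, and at least about N c (t - s), because the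
    kernel has integral N c over a period and is bounded uniformly in N away from its peak. Dividing
    by a large N concludes. *)
Lemma parseval_indic_itv : parseval F.
Proof.
have hF := L2_indic_itv; split => //; apply/eqP.
rewrite eq_le bessel_le//= L2n_indic_itv.
have := bessel_le hF; have := energy_ge0 F; have := energy_ge.
case: (energy F) => [E| |]// hE; rewrite !lee_fin => E0 _.
have main N d : 0 < d -> d <= c / 2 -> 2 * d <= t - s ->
    (t - s - 2 * d) * (N%:R * c - c * (4 / (2 - 2 * cos (2 * pi * b * d)))) <= N%:R * E.
  move=> d0 dc dts; set k := 4 / _.
  apply: (@le_trans _ _ (Rintegral mu A (J N))); last first.
    rewrite Rintegral_J.
    apply: (@le_trans _ _ (\sum_(j < N) E)); last by rewrite sumr_const card_ord mulr_natl.
    apply: ler_sum => j _.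
    (* For fixed j the frequencies j - l are distinct, so the j-th row is a partial sum of the
       energy. *)
    have := hE (map (fun l : 'I_N => j%:Z - l%:Z) (enum 'I_N)).
    rewrite lee_fin big_map big_enum; apply.
    by rewrite map_inj_uniq ?enum_uniq// => x y /addrI /oppr_inj [] /val_inj.
  pose A' := `[s + d, t - d]%classic.
  have mA' : measurable A' by exact: measurable_itv.
  have A'A : A' `<=` A.
    move=> x; rewrite /A /A' /= !in_itv/= => /andP[h1 h2]; apply/andP; split; lra.
  have -> : (t - s - 2 * d) * (N%:R * c - c * k) =
      Rintegral mu A (fun x => \1_A' x * (N%:R * c - c * k)).
    rewrite Rintegral_indic_mul// Rintegral_cst//= measure_itv_cc/=; last by lra.
    by ring.
  apply: le_Rintegral => //.
    have : mu.-integrable A (EFin \o (fun x => (N%:R * c - c * k) * \1_A' x)).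
      apply: integrableZ_EFin => //.
      exact: (integrableS (mu := mu) measurableT mA (@subsetT _ A)
        (integrable_indic_itv (s + d) (t - d) true false)).
    by apply: eq_integrable => // x _ /=; rewrite mulrC.
  exact: J_integrable.
  move=> x Ax; have J0 : 0 <= J N x by apply: Rintegral_ge0 => y _; exact: fejer_ge0.
  rewrite indicE; have [xA'|xA'] := boolP (x \in A'); last by rewrite mul0r.
  (* For x in [A'] the part of the period outside [A] is far from x, so it contributes at most c k
     to the total mass N c. *)
  rewrite mul1r lerBlDr -(Rintegral_fejer_period N x).
  have iI := integrable_fejer mI (integrable_trig 0 c) N x.
  have i1 : mu.-integrable I (EFin \o (fun y => \1_A y * fejer N (x - y))).
    apply: (le_integrable (mu := mu) mI _ _ iI).
      apply/measurable_EFinP; apply: measurable_funM.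
        by apply: measurable_funTS; exact: measurable_indic.
      by apply/measurable_EFinP; case/integrableP: iI.
    move=> y _ /=; rewrite lee_fin normrM ler_piMl// indicE.
    by case: (y \in A); rewrite ?normr1 ?normr0.
  have i2 : mu.-integrable I (EFin \o (fun=> k)).
    apply: measurable_bounded_integrable => //; last exact: bounded_cst.
    by rewrite /= measure_period ltry.
  rewrite -(@Rintegral_indic_mul I A)//.
  have -> : c * k = Rintegral mu I (fun=> k).
    by rewrite Rintegral_cst//= measure_period mulrC.
  rewrite -RintegralD//; apply: le_Rintegral => //.
    by have := integrableD (mu := mu) mI i1 i2; exact: eq_integrable.
  have k0 : 0 <= k.
    by rewrite divr_ge0// subr_ge0 ler_piMr// cos_le1.
  move=> y; rewrite /= in_itv/= => /andP[y0 yc]; rewrite indicE.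
  have [yA|yA] := boolP (y \in A); first by rewrite mul1r lerDl.
  rewrite mul0r add0r; apply: fejer_far => //.
  move: xA' yA; rewrite inE notin_setE /A /A' /= !in_itv/= => /andP[x1 x2].
  move=> /negP; rewrite negb_and -!ltNge => /orP[ys|ty].
    by apply: far_norm; rewrite // ?y0 ?yc//; left.
  by apply: far_norm; rewrite // ?y0 ?yc//; right.
apply/ler_addgt0Pr => e e0.
(* The first two bounds are those required by [main]. The third makes the loss 2 d c from shrinking
   the interval at most e / 2; N is then taken so large that the term with k costs at most another e
   / 2. *)
pose d := Num.min (c / 2) (Num.min ((t - s) / 2) (e / (4 * c))).
have ts0 : 0 < t - s by rewrite subr_gt0.
have d0 : 0 < d by rewrite !lt_min !divr_gt0// mulr_gt0.
have dc : d <= c / 2 by rewrite ge_min lexx.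
have dts : 2 * d <= t - s.
  by rewrite mulrC -ler_pdivlMr// /d !ge_min lexx orbT.
have de : 2 * d * c <= e / 2.
  have : d <= e / (4 * c) by rewrite /d !ge_min lexx !orbT.
  by rewrite ler_pdivlMr ?mulr_gt0//; lra.
have k0 : 0 <= 4 / (2 - 2 * cos (2 * pi * b * d)).
  by rewrite divr_ge0// subr_ge0 ler_piMr// cos_le1.
have {}main N := main N d d0 dc dts.
move: (4 / (2 - 2 * cos (2 * pi * b * d))) k0 main => k k0 main.
have [N Ne] : exists N : nat, (t - s) * c * k / (e / 2) < N%:R.
  by exists (Num.truncn ((t - s) * c * k / (e / 2))).+1; exact: truncnS_gt.
have N0 : 0 < N%:R :> R.
  apply: (le_lt_trans _ Ne); apply: divr_ge0.
    by apply: mulr_ge0 => //; apply: mulr_ge0; exact: ltW.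
  by apply: divr_ge0 => //; exact: ltW.
move: Ne; rewrite ltr_pdivrMr ?divr_gt0// => Ne.
have := main N => h.
rewrite -(ler_pM2l N0).
have h2 : 0 <= 2 * d * c * k by rewrite !mulr_ge0// ltW.
have h3 : N%:R * (2 * d * c) <= N%:R * (e / 2) by rewrite ler_pM2l.
nra.
Qed.

End fejer_interval.

(** * Parseval from intervals to all of L^2 on a period *)

Lemma parseval0 : parseval (fun=> 0).
Proof.
have := parsevalZ 0 (parseval_indic_itv (lexx 0) c0 (lexx c)).
by under eq_fun do rewrite mul0r.
Qed.

Lemma L2_le_bounded (u : R -> R) M : measurable_fun I u ->
  (forall x, I x -> u x ^+ 2 <= M) -> L2 I (fun x => (u x)%:C).
Proof.
move=> mu_ uM; have := @L2_bounded_mul I (fun=> 1) (fun x => (u x)%:C) M mI.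
rewrite (_ : (fun x => (u x)%:C * 1) = fun x => (u x)%:C); last first.
  by apply/funext => x; rewrite mulr1.
apply; [exact: cmeasurable_real| |exact: L2_1].
by move=> x Ix; rewrite sqmod_real uM.
Qed.

(** The exceptional point absorbs the endpoint by which half-open and closed intervals differ.
    Taking p outside I, such as c + 1, asks for equality on all of I. *)
Lemma parseval_ae F G p : L2 I F -> parseval G ->
  (forall x, I x -> x != p -> F x = G x) -> parseval F.
Proof.
move=> hF hG FG; apply: parseval_limit => // e e0; exists G => //.
rewrite L2n_Rintegral /Rintegral (ae_eq_integral (cst 0%E)) ?integral_cst//.
- by rewrite mul0e.
- by apply: measurable_sqmodE; have [] := L2B mI hF hG.1.
- exists [set p]; split => //; first exact: lebesgue_measure_set1.
  move=> x /=; apply: contra_notP => /eqP xp Ix.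
  by rewrite FG// subrr sqmod0.
Qed.

(** Dominated convergence: 0 <= u_n <= u bounds the squared error by u^2, so pointwise convergence
    is convergence in L^2. *)
Lemma parseval_cvg (u_ : nat -> R -> R) (u : R -> R) :
  (forall n, parseval (fun x => (u_ n x)%:C)) -> L2 I (fun x => (u x)%:C) ->
  (forall n x, I x -> 0 <= u_ n x <= u x) ->
  (forall x, I x -> u_ n x @[n --> \oo] --> u x) ->
  parseval (fun x => (u x)%:C).
Proof.
move=> hu_ hu u_u cvu; apply: parseval_limit => // e e0.
pose v_ n x := (sqmod ((u x)%:C - (u_ n x)%:C))%:E.
have mv n : measurable_fun I (v_ n).
  by apply: measurable_sqmodE; have [] := L2B mI hu (hu_ n).1.
have [] := @dominated_convergence _ _ _ mu I mI v_ (cst 0%E)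
    (fun x => (sqmod (u x)%:C)%:E) mv (measurable_cst _).
- apply/aeW => x Ix; apply: cvg_EFin; first exact: nearW.
  rewrite (_ : _ \o _ = fun n => (u x - u_ n x) * (u x - u_ n x)); last first.
    by apply/funext => n /=; rewrite -rmorphB sqmod_real expr2.
  rewrite -[X in _ --> X](mulr0 (u x - u x)) -[X in _ * X](subrr (u x)).
  by apply: cvgM; apply: cvgB; (try exact: cvg_cst); exact: cvu.
- exact: L2_integrable.
- apply/aeW => x n Ix; rewrite /v_ gee0_abs ?lee_fin ?sqmod_ge0//.
  rewrite -rmorphB !sqmod_real; have /andP[h1 h2] := u_u n x Ix.
  by rewrite ler_sqr ?nnegrE ?subr_ge0// ?(le_trans h1)// lerBlDr lerDl.
move=> _ _; rewrite integral0 => /fine_cvgP[_].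
move=> /cvgr0_norm_lt/(_ e e0) [N _ /(_ N (leqnn _))] /= h.
exists (fun x => (u_ N x)%:C) => //.
by apply: le_lt_trans h; exact: ler_norm.
Qed.

(** Dynkin's theorem with the half-open intervals as generating family closed under intersection:
    complements follow by linearity, disjoint unions as increasing limits of finite sums. *)
Lemma parseval_indic E : measurable E -> parseval (fun x => (\1_E x)%:C).
Proof.
move=> mE; have iL A : measurable A -> L2 I (fun x => (\1_A x)%:C).
  move=> mA; apply: (@L2_le_bounded _ 1).
    by apply: measurable_funTS; exact: measurable_indic.
  by move=> x _; rewrite indicE; case: (x \in A); rewrite ?expr1n ?expr0n.
apply: (@dynkin_induction _ (measurableTypeR R) (@ocitv R)
  (fun E => parseval (fun x => (\1_E x)%:C))) => //.
- exact: ocitvI.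
- apply: (parseval_ae (p := c + 1) _ (parseval_indic_itv (lexx 0) c0 (lexx c))).
    exact: iL.
  by move=> x Ix _; rewrite !indicE mem_setT mem_set.
(* Up to the point s, the trace of ]p, q] on the period is [s, t] when s < t, and empty
   otherwise. *)
- move=> A [[p q] _ <-] /=; pose s := Num.max p 0; pose t := Num.min q c.
  have mA : measurable `]p, q]%classic by exact: measurable_itv.
  have [st|ts] := ltP s t.
    have s0 : 0 <= s by rewrite le_max lexx orbT.
    have tc : t <= c by rewrite ge_min lexx orbT.
    apply: (parseval_ae (p := s) _ (parseval_indic_itv s0 st tc)); first exact: iL.
    move=> x /=; rewrite in_itv/= => /andP[x0 xc] xs; rewrite !indicE.
    congr (_%:R%:C); congr nat_of_bool; apply/idP/idP; rewrite !inE/= !in_itv/=.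
      move=> /andP[px xq]; apply/andP; split.
        by rewrite ge_max (ltW px).
      by rewrite le_min xq.
    rewrite ge_max le_min => /andP[/andP[px _] /andP[xq _]]; rewrite xq andbT.
    rewrite lt_neqAle px andbT; apply: contra_neq xs => px'.
    by rewrite /s px' max_l// -px'.
  apply: (parseval_ae (p := s) _ parseval0); first exact: iL.
  move=> x /=; rewrite in_itv/= => /andP[x0 xc] xs; rewrite indicE.
  rewrite memNset//= in_itv/= => /andP[px xq]; move/eqP: xs; apply.
  apply/eqP; rewrite eq_le; apply/andP; split.
    by apply: (le_trans _ ts); rewrite le_min xq.
  by rewrite ge_max (ltW px).
- move=> S mS hS.
  have := parsevalD (parsevalZ (-1) hS) (parseval_indic_itv (lexx 0) c0 (lexx c)).
  move=> h; apply: (parseval_ae (p := c + 1) _ h); first exact/iL/measurableC.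
  move=> x Ix _ /=; rewrite !indicE in_setC [X in _ + X](_ : _ = 1); last first.
    by rewrite mem_set.
  by case: (x \in S); rewrite /= ?mulr1 ?mulr0 ?addr0 ?addNr ?add0r.
- move=> F mF tF hF.
  have sumF k0 x (Fk0 : F k0 x) n : \sum_(k < n) \1_(F k) x = (k0 < n)%N%:R :> R.
    elim: n => [|n ih]; first by rewrite big_ord0.
    rewrite big_ord_recr/= ih indicE.
    have [->|kn] := eqVneq n k0; first by rewrite mem_set// ltnn ltnSn add0r.
    rewrite memNset; last first.
      move=> Fn; move/eqP: kn; apply.
      by apply: (tF n k0) => //; exists x.
    by rewrite addr0 ltnS [in RHS]leq_eqVlt [k0 == n]eq_sym (negbTE kn).
  have mU : measurable (\bigcup_k F k) by exact: bigcup_measurable.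
  apply: (@parseval_cvg (fun n x => \sum_(k < n) \1_(F k) x)).
  + elim=> [|n ih].
      under eq_fun do rewrite big_ord0; exact: parseval0.
    under eq_fun do rewrite big_ord_recr/= rmorphD/=.
    exact: parsevalD.
  + exact: iL.
  + move=> n x _; rewrite sumr_ge0//= indicE.
    have [xU|xU] := boolP (x \in _); last first.
      rewrite big1// => k _; rewrite indicE memNset// => Fk.
      by move: xU; rewrite notin_setE; apply; exists k.
    move: xU; rewrite inE => -[k0 _ Fk0]; rewrite (sumF k0)//.
    by case: (_ < _)%N.
  + move=> x _; rewrite indicE; have [xU|xU] := boolP (x \in _); last first.
      rewrite (_ : (fun _ => _) = cst 0); first exact: cvg_cst.
      apply/funext => n; rewrite big1// => k _; rewrite indicE memNset// => Fk.
      by move: xU; rewrite notin_setE; apply; exists k.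
    move: xU; rewrite inE => -[k0 _ Fk0]; apply: cvg_near_cst.
    exists k0.+1 => // n /= kn; rewrite (sumF k0)//.
    by rewrite kn.
Qed.

Lemma parseval_nnsfun (f : {nnsfun R >-> R}) : parseval (fun x => (f x)%:C).
Proof.
under eq_fun do rewrite fimfunE fsbig_finite//=.
elim: (enum_fset (fset_set (range f))) => [|k s ih].
  by under eq_fun do rewrite big_nil; exact: parseval0.
under eq_fun do rewrite big_cons rmorphD rmorphM/=.
apply: parsevalD => //; apply: parsevalZ; apply: parseval_indic.
exact: measurable_funPTI.
Qed.

Lemma parseval_nonneg (u : R -> R) : L2 I (fun x => (u x)%:C) ->
  (forall x, 0 <= u x) -> parseval (fun x => (u x)%:C).
Proof.
move=> hu u0; have [mu_ _] := hu.1.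
have mE : measurable_fun I (EFin \o u) by exact/measurable_EFinP.
have u0E x : I x -> (0 <= (EFin \o u) x)%E by rewrite /= lee_fin.
have cvu x : I x -> nnsfun_approx mI mE n x @[n --> \oo] --> u x.
  by move=> Ix; have := cvg_nnsfun_approx mI mE u0E Ix; move=> /fine_cvgP[_].
apply: (@parseval_cvg (fun n x => nnsfun_approx mI mE n x)) => //.
- by move=> n; exact: parseval_nnsfun.
- move=> n x Ix; rewrite fun_ge0/= -(cvg_lim _ (cvu x Ix))//.
  apply: nondecreasing_cvgn_le; last by apply/cvg_ex; exists (u x); exact: cvu.
  by move=> p q pq; apply/lefP; exact: nd_nnsfun_approx.
Qed.

(** Real and imaginary parts, and then their positive and negative parts, are dominated by |F| and
    so stay in L^2; linearity reassembles F. *)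
Lemma parseval_L2 F : L2 I F -> parseval F.
Proof.
have real u : L2 I (fun x => (u x)%:C) -> parseval (fun x => (u x)%:C).
  move=> hu; have [mu_ _] := hu.1.
  have part (v : R -> R) : measurable_fun I v -> (forall x, 0 <= v x <= `|u x|) ->
      parseval (fun x => (v x)%:C).
    move=> mv vu; apply: parseval_nonneg; last by move=> x; have /andP[] := vu x.
    split; first exact: cmeasurable_real.
    apply: le_lt_trans hu.2; apply: ge0_le_integral => //.
    - by move=> x _; rewrite lee_fin sqmod_ge0.
    - by apply: measurable_sqmodE; exact: cmeasurable_real.
    - by apply: measurable_sqmodE; exact: cmeasurable_real.
    - move=> x _; rewrite lee_fin !sqmod_real -[leRHS]real_normK ?num_real//.
      have /andP[h1 h2] := vu x.
      by rewrite ler_sqr ?nnegrE.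
  have h1 := part _ (measurable_funrpos mu_).
  have h2 := part _ (measurable_funrneg mu_).
  rewrite (_ : (fun x => _) = (fun x => (u^\+ x)%:C) \+ (fun x => -1 * (u^\- x)%:C)).
    apply: parsevalD; [apply: h1|apply/parsevalZ/h2] => x.
      by rewrite /funrpos le_max lexx orbT ge_max ler_norm normr_ge0.
    by rewrite /funrneg le_max lexx orbT ge_max normr_ge0 -normrN ler_norm.
  apply/funext => x /=; rewrite mulN1r -rmorphN -rmorphD/=.
  congr (_%:C); rewrite /funrpos /funrneg; have [h|h] := lerP 0 (u x).
    by rewrite max_r ?oppr_le0// subr0.
  by rewrite max_l ?opprK ?add0r// oppr_ge0 ltW.
move=> hF; have [mR mIm] := hF.1.
have sub (v : R -> R) : measurable_fun I v -> (forall x, v x ^+ 2 <= sqmod (F x)) ->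
    parseval (fun x => (v x)%:C).
  move=> mv vF; apply: real; split; first exact: cmeasurable_real.
  apply: le_lt_trans hF.2; apply: ge0_le_integral => //.
  - by move=> x _; rewrite lee_fin sqmod_ge0.
  - by apply: measurable_sqmodE; exact: cmeasurable_real.
  - by apply: measurable_sqmodE; exact: hF.1.
  - by move=> x _; rewrite lee_fin sqmod_real.
have hR := sub _ mR; have hI := sub _ mIm.
rewrite (_ : F = (fun x => (complex.Re (F x))%:C) \+
    (fun x => 'i%C * (complex.Im (F x))%:C)).
  apply: parsevalD; first by apply: hR => x; rewrite /sqmod lerDl sqr_ge0.
  by apply/parsevalZ/hI => x; rewrite /sqmod lerDr sqr_ge0.
by apply/funext => x; apply: complexP; rewrite !ReImE /=; ring.
Qed.

End Fourier.

(** * Unfolding and the bracket product *)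

Section translation_integral.
Context {R : realType}.
Local Notation mu := (@lebesgue_measure R).

Lemma measurable_subr (a : R) D : measurable_fun D (fun x : R => x - a).
Proof. by apply: measurable_funB => //; exact: measurable_cst. Qed.

Lemma measurable_shift d (T : measurableType d) (f : R -> T) (a : R) (D : set R) :
  measurable_fun [set: R] f -> measurable_fun D (fun x : R => f (x - a)).
Proof.
move=> mf; apply: measurable_funTS.
apply: (@measurableT_comp _ _ _ _ _ _ f); first exact: mf.
exact: measurable_subr.
Qed.

(** Lebesgue measure is determined by its values on half-open intervals, which translation
    preserves. *)
Lemma lebesgue_measure_shift (a : R) (A : set R) : measurable A ->
  pushforward mu ((fun x => x - a) : measurableTypeR R -> measurableTypeR R) A = mu A.
Proof.
move=> mA.
have ms : measurable_fun [set: measurableTypeR R]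
    ((fun x => x - a) : measurableTypeR R -> measurableTypeR R).
  exact: (measurable_subr a).
pose m := isMeasurableFun.Build _ _ _ _ _ ms.
pose phi : {mfun measurableTypeR R >-> measurableTypeR R} := HB.pack (fun x : measurableTypeR R => x - a) m.
apply/esym; apply: (@lebesgue_measure_unique _ (pushforward mu phi)) => // _ [[p q] _ <-].
have E : phi @^-1` `]p, q]%classic = `]p + a, q + a]%classic.
  by apply/seteqP; split => x /=; rewrite !in_itv/= ltrBrDr lerBlDr.
rewrite -[RHS]/(mu (phi @^-1` `]p, q]%classic)) E !lebesgue_measure_itv/= !lte_fin ltrD2r.
by case: ifP => // _; rewrite -!EFinB opprD addrACA subrr addr0.
Qed.

Lemma ge0_integral_shift (a : R) (D : set R) (f : R -> \bar R) : measurable D ->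
  measurable_fun [set: R] f -> (forall x, 0 <= f x)%E ->
  (\int[mu]_(x in D) f x = \int[mu]_(x in [set x | D (x - a)%R]) f (x - a)%R)%E.
Proof.
move=> mD mf f0.
have ms : measurable_fun [set: measurableTypeR R]
    ((fun x => x - a) : measurableTypeR R -> measurableTypeR R).
  exact: (measurable_subr a).
have := @ge0_integral_pushforward _ _ _ _ R _ ms mu D f mD (measurable_funTS mf)
  (fun y _ => f0 y).
move=> <-; apply: eq_measure_integral => //= A mA _.
exact/esym/lebesgue_measure_shift.
Qed.

Lemma cmeasurable_shift (a : R) (f : R -> R[i]) : cmeasurable [set: R] f ->
  cmeasurable [set: R] (fun x => f (x - a)).
Proof.
move=> [f1 f2]; split.
  exact: (measurable_shift (f := fun x => complex.Re (f x))).
exact: (measurable_shift (f := fun x => complex.Im (f x))).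
Qed.

Lemma L2_translation (s : R) (f : R -> R[i]) : L2 [set: R] f ->
  L2 [set: R] (translation s f).
Proof.
move=> [mf hf]; split; first exact: cmeasurable_shift.
rewrite /L2norm_sq /translation; move: hf; rewrite /L2norm_sq.
rewrite (ge0_integral_shift s measurableT (measurable_sqmodE mf)) //.
by move=> x; rewrite lee_fin sqmod_ge0.
Qed.

End translation_integral.

Section unfolding.
Context {R : realType}.
Variable c : R.
Hypothesis c0 : 0 < c.
Local Notation mu := (@lebesgue_measure R).
Local Notation I := `[0, c]%classic.

Let mI : measurable I. Proof. exact: measurable_itv. Qed.

Lemma unfold_ge0 (f : R -> \bar R) : measurable_fun [set: R] f ->
  (forall x, 0 <= f x)%E ->
  (\int[mu]_x f x =
   \int[mu]_(x in I) \esum_(k in [set: int]) f (x - k%:~R * c)%R)%E.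
Proof.
move=> mf f0.
have mfk (k : int) (D : set R) : measurable_fun D (fun x => f (x - k%:~R * c)).
  exact: measurable_shift.
(* Half-open tiles are disjoint; the endpoint they miss in [0, c] is null and is restored at the
   end. The sign is chosen so that shifting the argument by kc maps [0, c[ onto the k-th tile. *)
pose D (k : int) : set R := `[- (k%:~R * c), - (k%:~R * c) + c[%classic.
have mD k : measurable (D k) by exact: measurable_itv.
have -> : [set: R] = \bigcup_n D (nu n).
  apply/esym/seteqP; split => // y _.
  have [_ _ /(_ (- Num.floor (y / c)) Logic.I)] := nu_bij.
  move=> [n _ nE]; exists n => //; rewrite /D /= nE in_itv/= rmorphN mulNr opprK.
  rewrite -ler_pdivlMr// floor_le/= -[X in _ < _ + X]mul1r -mulrDl -ltr_pdivrMr//.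
  by have /andP[_] := floor_itv (y / c); rewrite intrD.
have tD : trivIset [set: nat] (fun n => D (nu n)).
  move=> i j _ _ [y []]; rewrite /D /= !in_itv/= => /andP[h1 h2] /andP[h3 h4].
  have [_ inj _] := nu_bij; apply: inj; rewrite ?inE//.
  suff {i j h1 h2 h3 h4} H (p q : int) : - (p%:~R * c) <= y -> y < - (q%:~R * c) + c ->
      (q <= p)%R.
    by apply/eqP; rewrite eq_le !H.
  move=> h1 h2; have : (q%:~R - p%:~R) * c < 1 * c by rewrite mulrBl; lra.
  rewrite ltr_pM2r// -intrB -[1]/(1%:~R) ltr_int ltrBlDr.
  by rewrite addrC ltzD1.
rewrite (ge0_integral_bigcup mu (F := fun n => D (nu n)) (f := f) (fun n => mD (nu n)) (measurable_funTS mf) (fun x _ => f0 x) tD).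
transitivity (\big[+%E/0]_(0 <= i <oo) \int[mu]_(x in `[0%R, c[) f (x - (nu i)%:~R * c)%R)%E.
  apply: eq_eseriesr => i _; rewrite [LHS](ge0_integral_shift ((nu i)%:~R * c))//.
  have -> // : [set x | D (nu i) (x - (nu i)%:~R * c)] = `[0, c[%classic.
  apply/seteqP; split => x /=; rewrite /D /= !in_itv/=.
    by move=> /andP[h1 h2]; apply/andP; split; lra.
  by move=> /andP[h1 h2]; apply/andP; split; lra.
rewrite -integral_nneseries//; last by move=> n; exact: mfk.
rewrite [RHS](_ : _ = \int[mu]_(x in `[0%R, c]) \sum_(i <oo) f (x - (nu i)%:~R * c)%R)%E.
  rewrite integral_itv_bndo_bndc//.
  apply: ge0_emeasurable_sum => // k _.
by apply: eq_integral => x _; rewrite esum_nu.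
Qed.

End unfolding.

Section fine_integral.
Context d (T : measurableType d) {R : realType} (mu : {measure set T -> \bar R}).

(** A finite integral makes [h] finite almost everywhere, so the value 0 that [fine] takes at
    infinity affects a null set only. *)
Lemma integral_fine (D : set T) (h : T -> \bar R) : measurable D ->
  measurable_fun D h -> (forall x, 0 <= h x)%E -> (\int[mu]_(x in D) h x < +oo)%E ->
  mu.-integrable D (EFin \o (fun x => fine (h x))) /\
  (Rintegral mu D (fun x => fine (h x)))%:E = (\int[mu]_(x in D) h x)%E.
Proof.
move=> mD mh h0 hoo.
have ih : mu.-integrable D h.
  apply/integrableP; split => //.
  by under eq_integral do rewrite gee0_abs//.
have mf : measurable_fun D (EFin \o (fun x => fine (h x))).
  by apply/measurable_EFinP; exact: measurableT_comp.
have E : (\int[mu]_(x in D) (fine (h x))%:E = \int[mu]_(x in D) h x)%E.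
  apply: ae_eq_integral => //.
  have := integrable_ae mD ih; apply: filterS => x hx Dx.
  by rewrite fineK// hx.
split; last by rewrite /Rintegral E fineK// ge0_fin_numE// integral_ge0.
apply/integrableP; split => //.
under eq_integral do rewrite gee0_abs ?lee_fin ?fine_ge0//.
by rewrite E.
Qed.

End fine_integral.

(** * Absolutely convergent real sums over Z *)

Section rsum.
Context {R : realType}.
Implicit Types (u v : int -> R).

Definition rsummable u := (\esum_(k in [set: int]) `|u k|%:E < +oo)%E.

Let P u : \bar R := (\esum_(k in [set: int]) (Num.max (u k) 0)%:E)%E.
Let N u : \bar R := (\esum_(k in [set: int]) (Num.max (- u k) 0)%:E)%E.

Let max0 (x : R) : 0 <= Num.max x 0.
Proof. by rewrite le_max lexx orbT. Qed.

Let maxN (x : R) : Num.max x 0 = x + Num.max (- x) 0.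
Proof.
have [h|h] := lerP 0 x; first by rewrite max_r ?oppr_le0// addr0.
by rewrite max_l ?subrr// oppr_ge0 ltW.
Qed.

Lemma esum_fin_le (a b : int -> R) : (forall k, 0 <= a k <= b k) ->
  (\esum_(k in [set: int]) (b k)%:E < +oo)%E ->
  (\esum_(k in [set: int]) (a k)%:E)%E \is a fin_num.
Proof.
move=> ab boo; rewrite ge0_fin_numE.
  apply: le_lt_trans boo; apply: le_esum => k _; rewrite lee_fin.
  by have /andP[] := ab k.
by apply: esum_ge0 => k _; rewrite lee_fin; have /andP[] := ab k.
Qed.

Let Pfin u : rsummable u -> P u \is a fin_num.
Proof.
by apply: esum_fin_le => k; rewrite max0 ge_max ler_norm normr_ge0.
Qed.

Let Nfin u : rsummable u -> N u \is a fin_num.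
Proof.
by apply: esum_fin_le => k; rewrite max0 ge_max -normrN ler_norm normr_ge0.
Qed.

Lemma rsummable_le u (b : int -> R) : (forall k, `|u k| <= b k) ->
  (\esum_(k in [set: int]) (b k)%:E < +oo)%E -> rsummable u.
Proof.
by move=> ub; apply: le_lt_trans; apply: le_esum => k _; rewrite lee_fin.
Qed.

Lemma rsummableD u v : rsummable u -> rsummable v ->
  rsummable (fun k => u k + v k).
Proof.
move=> su sv; apply: (@rsummable_le _ (fun k => `|u k| + `|v k|)).
  by move=> k; exact: ler_normD.
under eq_esum do rewrite EFinD.
by rewrite esumD ?lte_add_pinfty// => k _; rewrite lee_fin.
Qed.

Lemma rsummableZ (r : R) u : rsummable u -> rsummable (fun k => r * u k).
Proof.
move=> su; rewrite /rsummable; under eq_esum do rewrite normrM EFinM.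
by rewrite esumZl// lte_mul_pinfty.
Qed.

Lemma rsumD u v : rsummable u -> rsummable v ->
  rsum (fun k => u k + v k) = rsum u + rsum v.
Proof.
move=> su sv; have suv := rsummableD su sv.
(* Written this way the relation between positive and negative parts involves only sums of
   nonnegative terms; subtraction happens after all six are known to be finite. *)
have : (P (u \+ v)%R + (N u + N v) = N (u \+ v)%R + (P u + P v))%E.
  rewrite /P /N -!esumD; try by move=> k _; rewrite ?adde_ge0 ?lee_fin.
  apply: eq_esum => k _; rewrite -!EFinD; congr EFin => /=.
  by rewrite (maxN (u k + v k)) (maxN (u k)) (maxN (v k)); ring.
have Pu := Pfin su; have Pv := Pfin sv; have Puv := Pfin suv.
have Nu := Nfin su; have Nv := Nfin sv; have Nuv := Nfin suv.
move=> /(congr1 fine); rewrite !fineD ?fin_numD ?Pu ?Pv ?Nu ?Nv//.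
rewrite /rsum -/(P u) -/(N u) -/(P v) -/(N v) -/(P (u \+ v)) -/(N (u \+ v)).
lra.
Qed.

Lemma rsumN u : rsum (fun k => - u k) = - rsum u.
Proof. by rewrite /rsum; under [X in _ - fine X]eq_esum do rewrite opprK; rewrite opprB. Qed.

Lemma rsumZ (r : R) u : rsum (fun k => r * u k) = r * rsum u.
Proof.
have H (q : R) : 0 <= q -> rsum (fun k => q * u k) = q * rsum u.
  move=> q0; rewrite /rsum.
  under eq_esum do rewrite -(mulr0 q) -maxr_pMr// EFinM.
  rewrite esumZl//; last by move=> k; rewrite lee_fin.
  under [X in _ - fine X]eq_esum do rewrite -mulrN -(mulr0 q) -maxr_pMr// EFinM.
  rewrite esumZl//; last by move=> k; rewrite lee_fin.
  (* Both infinities are sent to 0 by [fine], so it commutes with real scaling at infinite values as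
     well. *)
  have fineM (x : \bar R) : fine (q%:E * x) = q * fine x.
    case: x => [x| |] //=; rewrite ?mulr0// /mule/=.
      by case: (_ == _) => //; case: (_ < _)%E.
    by case: (_ == _) => //; case: (_ < _)%E.
  by rewrite !fineM mulrBr.
have [r0|r0] := lerP 0 r; first exact: H.
have := H (- r); rewrite oppr_ge0 => /(_ (ltW r0)).
under eq_fun do rewrite mulNr.
by rewrite rsumN mulNr => /oppr_inj.
Qed.

Lemma rsum_ge0 u : (forall k, 0 <= u k) ->
  rsum u = fine (\esum_(k in [set: int]) (u k)%:E)%E.
Proof.
move=> u0; rewrite /rsum; under eq_esum do rewrite max_l//.
by rewrite [X in _ - fine X]esum1 ?subr0// => k _; rewrite max_r// oppr_le0.
Qed.

End rsum.

(** * The module inner product at a fixed point *)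

Section bracket.
Context {R : realType}.
Variable c : R.
Hypothesis c0 : 0 < c.
Local Notation mu := (@lebesgue_measure R).
Local Notation I := `[0, c]%classic.
Local Notation ip := (Linf_l2_inner c).
Implicit Types f h : R -> R[i].

Let mI : measurable I. Proof. exact: measurable_itv. Qed.

(** The periodized square <f,f> with values in [0, +oo], hence meaningful at every x; [bracket_self]
    relates it to the inner product through [fine]. *)
Definition persq f x : \bar R :=
  (\esum_(k in [set: int]) (sqmod (f (x - k%:~R * c)))%:E)%E.

Lemma persq_ge0 f x : (0 <= persq f x)%E.
Proof. by apply: esum_ge0 => k _; rewrite lee_fin sqmod_ge0. Qed.

Lemma measurable_persq D f : cmeasurable [set: R] f -> measurable_fun D (persq f).
Proof.
move=> mf; apply: measurable_esum => [k x|k]; first by rewrite lee_fin sqmod_ge0.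
by apply: measurable_sqmodE; have [h1 h2] := cmeasurable_shift (k%:~R * c) mf;
  split; exact: measurable_funTS.
Qed.

Lemma integral_persq f : cmeasurable [set: R] f ->
  (\int[mu]_(x in I) persq f x)%E = L2norm_sq [set: R] f.
Proof.
move=> mf; rewrite /L2norm_sq (unfold_ge0 c0)//; first exact: measurable_sqmodE.
by move=> x; rewrite lee_fin sqmod_ge0.
Qed.

Lemma esum_shift (a : int -> \bar R) (j : int) :
  (\esum_(k in [set: int]) a (k + j)%R = \esum_(k in [set: int]) a k)%E.
Proof.
apply/esym; apply: (@reindex_esum _ _ _ [set: int] [set: int] (fun k => k + j)).
split => // [k l _ _ /addIr//|k _].
by exists (k - j) => //; rewrite subrK.
Qed.

Lemma persq_period f x (j : int) : persq f (x - j%:~R * c) = persq f x.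
Proof.
rewrite -[RHS](esum_shift _ j); apply: eq_esum => k _.
by congr (sqmod (f _))%:E; rewrite intrD; ring.
Qed.

Lemma persq_ae_fin f : L2 [set: R] f ->
  {ae mu, forall x, I x -> persq f x \is a fin_num}.
Proof.
move=> [mf hf]; apply: (integrable_ae (mu := mu) mI (f := persq f)).
apply/integrableP; split; first exact: measurable_persq.
under eq_integral do rewrite gee0_abs ?persq_ge0//.
by rewrite integral_persq.
Qed.

Section at_point.
Variables (f h : R -> R[i]) (x : R).
Hypotheses (ff : persq f x \is a fin_num) (hh : persq h x \is a fin_num).
Let p (k : int) : R[i] := f (x - k%:~R * c) * (h (x - k%:~R * c))^*%C.

Let sumoo : (\esum_(k in [set: int])
   (sqmod (f (x - k%:~R * c)) + sqmod (h (x - k%:~R * c)))%:E < +oo)%E.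
Proof.
under eq_esum do rewrite EFinD.
rewrite esumD; try by move=> k _; rewrite lee_fin sqmod_ge0.
by rewrite lte_add_pinfty// -ge0_fin_numE// persq_ge0.
Qed.

Lemma bracket_summable : rsummable (fun k => complex.Re (p k)) /\
  rsummable (fun k => complex.Im (p k)).
Proof.
split; apply: rsummable_le sumoo => k.
  by rewrite -[X in _ <= _ + X]sqmodC normRe_le.
by rewrite -[X in _ <= _ + X]sqmodC normIm_le.
Qed.

Lemma rsum_persq (g : R -> R[i]) :
  rsum (fun k => sqmod (g (x - k%:~R * c))) = fine (persq g x).
Proof. by rewrite rsum_ge0// => k; exact: sqmod_ge0. Qed.

Lemma persq_rsummable (g : R -> R[i]) : persq g x \is a fin_num ->
  rsummable (fun k => sqmod (g (x - k%:~R * c))).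
Proof.
move=> gg; apply: (@rsummable_le _ _ (fun k => sqmod (g (x - k%:~R * c)))).
  by move=> k; rewrite ger0_norm ?sqmod_ge0.
by rewrite -/(persq g x) -ge0_fin_numE// persq_ge0.
Qed.

(** The right-hand side is the sum over k of |f - l h|^2 at the points x - kc. *)
Lemma bracket_quadratic (l : R[i]) :
  0 <= fine (persq f x) - 2 * complex.Re (l^*%C * ip f h x) + sqmod l * fine (persq h x).
Proof.
have [s1 s2] := bracket_summable.
have sf := persq_rsummable ff; have sh := persq_rsummable hh.
have -> : fine (persq f x) - 2 * complex.Re (l^*%C * ip f h x) + sqmod l * fine (persq h x)
  = rsum (fun k => sqmod (f (x - k%:~R * c) - l * h (x - k%:~R * c))).
  rewrite (_ : (fun k => sqmod _) = fun k => sqmod (f (x - k%:~R * c)) +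
    ((- 2 * complex.Re l) * complex.Re (p k) + ((- 2 * complex.Im l) * complex.Im (p k) +
     sqmod l * sqmod (h (x - k%:~R * c))))).
    have z1 := rsummableZ (- 2 * complex.Re l) s1.
    have z2 := rsummableZ (- 2 * complex.Im l) s2.
    have z3 := rsummableZ (sqmod l) sh.
    rewrite (rsumD sf (rsummableD z1 (rsummableD z2 z3))).
    rewrite (rsumD z1 (rsummableD z2 z3)) (rsumD z2 z3) !rsumZ !rsum_persq.
    by rewrite cReM cReC cImC /=; ring.
  apply/funext => k; rewrite /sqmod /p !ReImE; ring.
rewrite rsum_ge0; first by apply/fine_ge0/esum_ge0 => k _; rewrite lee_fin sqmod_ge0.
by move=> k; exact: sqmod_ge0.
Qed.

Lemma bracket_CS : sqmod (ip f h x) <= fine (persq f x) * fine (persq h x).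
Proof.
set z := ip f h x; set A := fine (persq f x); set B := fine (persq h x).
have A0 : 0 <= A by apply/fine_ge0/persq_ge0.
have B0 : 0 <= B by apply/fine_ge0/persq_ge0.
have q (t : R) : 0 <= A - 2 * (t * sqmod z) + t ^+ 2 * sqmod z * B.
  have := bracket_quadratic (t%:C * z); rewrite -/z -/A -/B sqmodM sqmod_real.
  by congr (0 <= _ - 2 * _ + _); rewrite /sqmod !ReImE /=; ring.
have [B00|Bn0] := eqVneq B 0.
  rewrite B00 mulr0 leNgt; apply/negP => z0.
  (* With B = 0 the quadratic degenerates to a linear function of t; this t gives it the value
     -1. *)
  have := q ((A + 1) / (2 * sqmod z)); rewrite B00 mulr0 addr0.
  rewrite (_ : 2 * _ = A + 1); last by field; rewrite gt_eqF.
  by lra.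
have Bp : 0 < B by rewrite lt_neqAle eq_sym Bn0.
(* The minimizer of the quadratic in t. *)
have := q B^-1.
rewrite (_ : _ + _ = A - sqmod z / B); last by field.
by rewrite subr_ge0 ler_pdivrMr.
Qed.

Lemma csumZ (z : R[i]) : csum (fun k => z * p k) = z * csum p.
Proof.
have [s1 s2] := bracket_summable.
apply: complexP; rewrite ?cReM ?cImM /=.
- under eq_fun do rewrite cReM -mulNr.
  by rewrite rsumD ?rsumZ ?mulNr//; exact: rsummableZ.
- under eq_fun do rewrite cImM.
  by rewrite rsumD ?rsumZ//; exact: rsummableZ.
Qed.

End at_point.

Lemma bracket_self f x : ip f f x = (fine (persq f x))%:C.
Proof.
apply: complexP => /=.
  by under eq_fun do rewrite mulC_conj; exact: rsum_persq.
under eq_fun do rewrite mulC_conj.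
by rewrite rsum_ge0// esum1.
Qed.

Lemma measurable_rsum (D : set R) (u : int -> R -> R) :
  (forall k, measurable_fun D (u k)) -> measurable_fun D (fun x => rsum (fun k => u k x)).
Proof.
move=> mu_; have part (v : int -> R -> R) : (forall k, measurable_fun D (v k)) ->
    measurable_fun D (fun x => fine (\esum_(k in [set: int]) (Num.max (v k x) 0)%:E)%E).
  move=> mv; apply: (@measurableT_comp _ _ _ _ _ _ fine) => //.
  apply: measurable_esum => [k x|k]; first by rewrite lee_fin le_max lexx orbT.
  by apply/measurable_EFinP; apply: measurable_maxr => //; exact: measurable_cst.
apply: measurable_funB; first exact: part.
by apply: part => k; exact: measurable_funN.
Qed.

Lemma measurable_bracket D f h : cmeasurable [set: R] f -> cmeasurable [set: R] h ->
  cmeasurable D (ip f h).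
Proof.
move=> mf mh.
have m k : cmeasurable D (fun x => f (x - k%:~R * c) * (h (x - k%:~R * c))^*%C).
  have [h1 h2] := cmeasurableM (cmeasurable_shift (k%:~R * c) mf)
    (cmeasurableC (cmeasurable_shift (k%:~R * c) mh)).
  by split; exact: measurable_funTS.
by split; apply: measurable_rsum => k; have [] := m k.
Qed.

End bracket.

Section ae_lemmas.
Context d (T : measurableType d) {R : realType} (mu : {measure set T -> \bar R}).

Lemma ae_imp (P Q : T -> Prop) : {ae mu, forall x, P x} ->
  (forall x, P x -> Q x) -> {ae mu, forall x, Q x}.
Proof. by move=> + PQ; apply: filterS. Qed.

Lemma ae_imp2 (P Q S : T -> Prop) : {ae mu, forall x, P x} ->
  {ae mu, forall x, Q x} -> (forall x, P x -> Q x -> S x) ->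
  {ae mu, forall x, S x}.
Proof. by move=> + + PQ; apply: filterS2. Qed.

Lemma ae_and (A P Q : T -> Prop) : {ae mu, forall x, A x -> P x} ->
  {ae mu, forall x, A x -> Q x} -> {ae mu, forall x, A x -> P x /\ Q x}.
Proof. by apply: filterS2 => x hP hQ Ax; split; [exact: hP|exact: hQ]. Qed.

End ae_lemmas.

(** * Fourier coefficients of the bracket *)

Section unfolding_inner.
Context {R : realType}.
Variables b c : R.
Hypotheses (c0 : 0 < c) (bc : b * c = 1).
Local Notation mu := (@lebesgue_measure R).
Local Notation I := `[0, c]%classic.
Local Notation ip := (Linf_l2_inner c).
Implicit Types f h : R -> R[i].

Let mI : measurable I. Proof. exact: measurable_itv. Qed.

(** Both the real integral and [rsum] are differences of a positive and a negative part, so each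
    part unfolds by [unfold_ge0]. *)
Lemma unfold_Rintegral (u : R -> R) : mu.-integrable [set: R] (EFin \o u) ->
  Rintegral mu [set: R] u =
  Rintegral mu I (fun x => rsum (fun k : int => u (x - k%:~R * c))).
Proof.
move=> iu; have mu_ : measurable_fun [set: R] u.
  by apply/measurable_EFinP; case/integrableP: iu.
have part (v : R -> R) : measurable_fun [set: R] v -> (forall x, 0 <= v x) ->
    mu.-integrable [set: R] (EFin \o v) ->
    mu.-integrable I (EFin \o (fun x => fine (\esum_(k in [set: int]) (v (x - k%:~R * c))%:E)%E)) /\
    Rintegral mu I (fun x => fine (\esum_(k in [set: int]) (v (x - k%:~R * c))%:E)%E) =
    Rintegral mu [set: R] v.
  move=> mv v0 iv.
  have mvE : measurable_fun [set: R] (EFin \o v) by exact/measurable_EFinP.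
  have E := @unfold_ge0 _ _ c0 (EFin \o v) mvE v0.
  have vfin : (\int[mu]_x (v x)%:E)%E \is a fin_num by exact: integrable_fin_num.
  have [] := @integral_fine _ _ R mu I
    (fun x => \esum_(k in [set: int]) (v (x - k%:~R * c))%:E)%E mI.
  - apply: measurable_esum => [k x|k]; first by rewrite lee_fin.
    by apply/measurable_EFinP; exact: (measurable_shift (f := v)).
  - by move=> x; apply: esum_ge0 => k _; rewrite lee_fin.
  - by rewrite -E -ge0_fin_numE//; apply: integral_ge0 => x _; rewrite lee_fin.
  move=> h1 h2; split => //.
  by apply: EFin_inj; rewrite h2 -E /Rintegral fineK.
have i1 := integrable_funrpos measurableT iu.
have i2 := integrable_funrneg measurableT iu.
have [p1 p2] := part _ (measurable_funrpos mu_) (funrpos_ge0 u) i1.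
have [n1 n2] := part _ (measurable_funrneg mu_) (funrneg_ge0 u) i2.
rewrite [RHS](_ : _ = Rintegral mu I (fun x => fine
    (\esum_(k in [set: int]) (u^\+ (x - k%:~R * c))%:E)%E -
    fine (\esum_(k in [set: int]) (u^\- (x - k%:~R * c))%:E)%E))//.
rewrite RintegralB// p2 n2 -RintegralB//.
apply: eq_Rintegral => x _; rewrite /funrpos /funrneg.
have [h|h] := lerP 0 (u x); first by rewrite max_r ?oppr_le0// subr0.
by rewrite max_l ?opprK ?add0r// oppr_ge0 ltW.
Qed.

Lemma L2_modulation (w : R) f : L2 [set: R] f -> L2 [set: R] (modulation w f).
Proof.
move=> hf; apply: (@L2_bounded_mul _ [set: R] f (fun x => expi (2 * pi * w * x)) 1) => //.
- exact: cmeasurable_expi.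
- by move=> x _; rewrite sqmod_expi.
Qed.

(** The character is c-periodic because b c = 1, so it comes out of the periodized sum. This is done
    at points where the periodized squares of f and h are finite, that is, almost everywhere. *)
Lemma L2inner_modulation f h (m : int) : L2 [set: R] f -> L2 [set: R] h ->
  L2inner [set: R] f (modulation (m%:~R * b) h) = coef b c m (ip f h).
Proof.
move=> hf hh; have hm := L2_modulation (m%:~R * b) hh.
have [iR iI] := L2_mul_integrable measurableT hf (L2_conj hm).
pose q x k : R[i] := f (x - k%:~R * c) * (h (x - k%:~R * c))^*%C.
have E : {ae mu, forall x, I x -> csum (fun k : int => (chi b m x)^*%C * q x k) =
    ip f h x * (chi b m x)^*%C}.
  apply: (ae_imp2 (persq_ae_fin c0 hh) (persq_ae_fin c0 hf)) => x h1 h2 Ix.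
  by rewrite (csumZ (h2 Ix) (h1 Ix)) mulrC.
have qE x (k : int) : f (x - k%:~R * c) * (modulation (m%:~R * b) h (x - k%:~R * c))^*%C
    = (chi b m x)^*%C * q x k.
  rewrite -(chi_period bc m k x) /modulation -/(expi _) -/(chi b m _) rmorphM/=.
  by rewrite /q mulrCA.
have mip := measurable_bracket c I hf.1 hh.1.
have [m1 m2] := cmeasurableM mip (cmeasurableC (cmeasurable_chi b m I)).
have mq (k : int) : cmeasurable I (fun x => (chi b m x)^*%C * q x k).
  apply: cmeasurableM; first exact/cmeasurableC/cmeasurable_chi.
  have [h1 h2] := cmeasurableM (cmeasurable_shift (k%:~R * c) hf.1)
    (cmeasurableC (cmeasurable_shift (k%:~R * c) hh.1)).
  by split; exact: measurable_funTS.
rewrite /coef /L2inner /cintegral; congr (_ +i* _); rewrite unfold_Rintegral//.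
- under [X in Rintegral _ _ X]eq_fun do under eq_fun do rewrite qE.
  rewrite /Rintegral; congr fine; apply: ae_eq_integral => //.
  + apply/measurable_EFinP; apply: measurable_rsum => k; exact: (mq k).1.
  + exact/measurable_EFinP.
  + by apply: (ae_imp E) => x h1 Ix; rewrite -(h1 Ix).
- under [X in Rintegral _ _ X]eq_fun do under eq_fun do rewrite qE.
  rewrite /Rintegral; congr fine; apply: ae_eq_integral => //.
  + apply/measurable_EFinP; apply: measurable_rsum => k; exact: (mq k).2.
  + exact/measurable_EFinP.
  + by apply: (ae_imp E) => x h1 Ix; rewrite -(h1 Ix).
Qed.

(** For f and h in L^2 the bracket is in general only integrable, so its square integrability is
    assumed here and supplied later by [L2_bracket] or by cutting. *)
Lemma parseval_bracket f h : L2 [set: R] f -> L2 [set: R] h -> L2 I (ip f h) ->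
  (\esum_(m in [set: int]) (sqmod (L2inner [set: R] f (modulation (m%:~R * b) h)))%:E
   = c%:E * L2norm_sq I (ip f h))%E.
Proof.
move=> hf hh hfh; under eq_esum do rewrite L2inner_modulation//.
by have [_] := parseval_L2 c0 bc hfh; rewrite /energy => ->; rewrite EFinM L2nE.
Qed.

End unfolding_inner.

(** * From integral inequalities to inequalities almost everywhere *)

Section ae_comparison.
Context {R : realType}.
Local Notation mu := (@lebesgue_measure R).

(** On the set where v < u, both inequalities between the integrals hold over every measurable
    subset, so u = v almost everywhere there; the set must then be null. *)
Lemma ae_le_of_integral_le (D : set R) (u v : R -> \bar R) : measurable D ->
  measurable_fun D u -> measurable_fun D v ->
  (forall x, 0 <= u x)%E -> (forall x, 0 <= v x)%E ->
  (\int[mu]_(x in D) v x < +oo)%E ->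
  (forall E, measurable E -> E `<=` D ->
    \int[mu]_(x in E) u x <= \int[mu]_(x in E) v x)%E ->
  {ae mu, forall x, D x -> (u x <= v x)%E}.
Proof.
move=> mD mu_ mv u0 v0 voo uv.
pose E := D `&` [set x | (v x < u x)%E].
have mE : measurable E by exact: measurable_lte.
have ED : E `<=` D by move=> x [].
have mvE := measurable_funS mD ED mv; have muE := measurable_funS mD ED mu_.
have iv : mu.-integrable E v.
  apply: (integrableS (mu := mu) mD mE ED); apply/integrableP; split => //.
  by under eq_integral do rewrite gee0_abs//.
have aevu : ae_eq mu E v u.
  apply: integral_ae_eq => // A AE mA.
  apply/eqP; rewrite eq_le; apply/andP; split; last first.
    by apply: uv => //; exact: subset_trans AE ED.
  apply: ge0_le_integral => //; try exact: measurable_funS AE _.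
  by move=> x Ax; have [_ /ltW] := AE _ Ax.
apply: (ae_imp aevu) => x vu Dx; rewrite leNgt; apply/negP => h.
by have := vu (conj Dx h); move: h => /[swap] ->; rewrite ltxx.
Qed.

End ae_comparison.

(** * Essential suprema over a period as bounds almost everywhere *)

Section ess_sup_period.
Context {R : realType}.
Variable c : R.
Local Notation mu := (@lebesgue_measure R).
Local Notation I := `[0, c]%classic.

Lemma ess_sup0c_ltyP (F : R -> \bar R) :
  (ess_sup0c c F < +oo)%E <->
  exists M : R, {ae mu, forall x, I x -> (F x <= M%:E)%E}.
Proof.
split.
- move=> h; have [M hM] : exists M : R, (ess_sup0c c F <= M%:E)%E.
    move: h; case: (ess_sup0c c F) => [r| |]// _; first by exists r.
    by exists 0; rewrite leNye.
  exists M; have := elimT ess_supP hM => -[N [mN N0 NF]].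
  exists (N `&` I); split.
  + by apply: measurableI => //; exact: measurable_itv.
  + exact: N0.
  + move=> x /= /not_implyP [Ix FM]; split => //.
    exact: NF.
- move=> [M [N [mN N0 NF]]]; apply: (@le_lt_trans _ _ M%:E); last exact: ltry.
  apply/ess_supP; exists (N `|` ~` I); split.
  + by apply: measurableU => //; apply: measurableC; exact: measurable_itv.
  + rewrite -[LHS]/(mu ((N `|` ~` I) `&` I)) setIUl setICl setU0.
    apply: (subset_measure0 _ _ _ N0) => //.
    by apply: measurableI => //; exact: measurable_itv.
  + move=> x FM; have [Ix|nIx] := pselect (I x); last by right.
    by left; apply: NF => /= /(_ Ix).
Qed.

Lemma LinfP (p : R -> R[i]) : Linf c p <-> cmeasurable I p /\
  exists M : R, {ae mu, forall x, I x -> sqmod (p x) <= M}.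
Proof.
split=> -[mp]; move=> h; split => //.
- move/ess_sup0c_ltyP : h => [M h]; exists (M ^+ 2).
  apply: (ae_imp h) => x {}h Ix; have := h Ix; rewrite lee_fin => {}h.
  rewrite -[leLHS]sqr_sqrtr ?sqmod_ge0// ler_sqr ?nnegrE ?sqrtr_ge0//.
  by apply: le_trans h; rewrite sqrtr_ge0.
- move: h => [M h]; apply/ess_sup0c_ltyP; exists (Num.sqrt M).
  apply: (ae_imp h) => x {}h Ix; rewrite lee_fin.
  by rewrite ler_wsqrtr// h.
Qed.

Lemma Linf_l2P (f : R -> R[i]) : Linf_l2 c f <-> cmeasurable [set: R] f /\
  exists M : R, {ae mu, forall x, I x -> (persq c f x <= M%:E)%E}.
Proof.
by split=> -[mf h]; split => //; exact/ess_sup0c_ltyP.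
Qed.

End ess_sup_period.

(** * Cutting functions to periodic sets *)

Section cut.
Context {R : realType}.
Variable c : R.
Hypothesis c0 : 0 < c.
Local Notation mu := (@lebesgue_measure R).
Local Notation I := `[0, c]%classic.
Local Notation ip := (Linf_l2_inner c).
Implicit Types (f h : R -> R[i]) (Z E : set R).

Definition periodic Z := forall (k : int) x, Z (x - k%:~R * c) = Z x.

Definition periodize E : set R := [set x | E (x - (Num.floor (x / c))%:~R * c)].

Lemma periodic_periodize E : periodic (periodize E).
Proof.
move=> k x; rewrite /periodize /=; congr E.
have -> : (x - k%:~R * c) / c = x / c + (- k)%:~R.
  by rewrite mulrBl mulfK ?gt_eqF// rmorphN.
by rewrite floorDrz ?intr_int// intrKfloor intrD rmorphN; ring.
Qed.

Lemma periodizeE E x : 0 <= x < c -> periodize E x = E x.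
Proof.
move=> /andP[x0 xc]; rewrite /periodize /= (_ : Num.floor _ = 0) ?mul0r ?subr0//.
apply: floor_def; rewrite add0r divr_ge0// ?ltW//=.
by rewrite ltr_pdivrMr// mul1r.
Qed.

Lemma measurable_periodize E : measurable E -> measurable (periodize E).
Proof.
move=> mE; rewrite -[periodize E]setTI.
suff m : measurable_fun [set: R] (fun x : R => x - (Num.floor (x / c))%:~R * c).
  exact: m.
apply: measurable_funB => //; apply: measurable_funM => //.
apply: nondecreasing_measurable => // x y xy.
by rewrite ler_int le_floor// ler_pM2r// invr_gt0.
Qed.

(** For periodic Z this is the module action of the projection given by the indicator of Z, so
    brackets are merely multiplied by that indicator. *)
Definition cut Z f : R -> R[i] := fun x => (\1_Z x)%:C * f x.

Lemma L2_cut Z f : measurable Z -> L2 [set: R] f -> L2 [set: R] (cut Z f).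
Proof.
move=> mZ hf; apply: (@L2_bounded_mul _ _ f (fun x => (\1_Z x)%:C) 1) => //.
  by apply: cmeasurable_real; exact: measurable_indic.
by move=> x _; rewrite sqmod_real indicE; case: (x \in Z); rewrite ?expr1n ?expr0n.
Qed.

Lemma indic_period Z (k : int) x : periodic Z -> \1_Z (x - k%:~R * c) = \1_Z x :> R.
Proof.
move=> pZ; rewrite !indicE; congr (nat_of_bool _)%:R.
by apply/idP/idP; rewrite !inE pZ.
Qed.

Lemma persq_cut Z f x : periodic Z ->
  persq c (cut Z f) x = ((\1_Z x)%:E * persq c f x)%E.
Proof.
move=> pZ; rewrite /persq /cut -esumZl//; last by move=> k; rewrite lee_fin sqmod_ge0.
apply: eq_esum => k _; rewrite indic_period// sqmodM sqmod_real EFinM.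
by congr (_%:E * _)%E; rewrite indicE; case: (x \in Z); rewrite ?expr1n ?expr0n.
Qed.

Lemma bracket_cut Z f h x : periodic Z ->
  ip (cut Z f) h x = (\1_Z x)%:C * ip f h x.
Proof.
move=> pZ; rewrite /Linf_l2_inner /cut.
under eq_fun do rewrite indic_period// -mulrA.
rewrite indicE; case: (x \in Z) => /=.
  by rewrite mul1r; under eq_fun do rewrite mul1r.
rewrite mul0r; under eq_fun do rewrite mul0r.
by apply: complexP; rewrite /= /rsum oppr0 subrr.
Qed.

(** On [0, c[ the periodic extension agrees with E. The point c, which is identified with 0, is kept
    out of E and has measure zero. *)
Lemma integral_period_indic E (F : R -> \bar R) : measurable E ->
  E `<=` `[0, c[%classic -> measurable_fun I F ->
  (\int[mu]_(x in I) ((\1_(periodize E) x)%:E * F x) = \int[mu]_(x in E) F x)%E.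
Proof.
move=> mE Ec mF.
have mIF : measurable_fun I (fun x => (\1_(periodize E) x)%:E * F x)%E.
  apply: emeasurable_funM => //; apply/measurable_EFinP; apply: measurable_funTS.
  by apply: measurable_indic; exact: measurable_periodize.
rewrite -[in RHS](setIidr Ec) integral_mkcondr -[LHS]integral_itv_bndo_bndc//; last first.
  apply: measurable_funS mIF => // x /=; rewrite !in_itv/= => /andP[-> /ltW ->].
  by [].
apply: eq_integral => x; rewrite inE/= in_itv/= => xc.
rewrite patchE indicE.
have -> : (x \in periodize E) = (x \in E).
  by apply/idP/idP; rewrite !inE periodizeE.
by case: ifPn => _; rewrite ?mul1e ?mul0e.
Qed.

Lemma ae_period (P : R -> Prop) :
  {ae mu, forall x, `[0, c[%classic x -> P x} -> {ae mu, forall x, I x -> P x}.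
Proof.
move=> [N [mN N0 NP]]; exists (N `|` [set c]); split.
- exact: measurableU.
- by rewrite measureU0//; exact: lebesgue_measure_set1.
- move=> x /= /not_implyP[]; rewrite in_itv/= => /andP[x0 xc] nP.
  have [->|xnc] := eqVneq x c; first by right.
  left; apply: NP => /= h; apply: nP; apply: h.
  by rewrite in_itv/= x0 lt_neqAle xnc.
Qed.

End cut.

(** * Strong sums of multiplication operators *)

Section strong_sums.
Context {R : realType}.
Variable c : R.
Hypothesis c0 : 0 < c.
Local Notation mu := (@lebesgue_measure R).
Local Notation I := `[0, c]%classic.

Let mI : measurable I. Proof. exact: measurable_itv. Qed.

Lemma Linf_le_elim p q : Linf_le c p q ->
  {ae mu, forall x, I x -> complex.Re (p x) <= complex.Re (q x)}.
Proof.
move=> [k _ hk]; apply: (ae_imp hk) => x {}hk Ix.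
have := congr1 (@complex.Re R) (hk Ix).
rewrite mulrC mulC_conj cReD cReN /= => h.
by rewrite -subr_ge0 h sqmod_ge0.
Qed.

(** The witness is the square root of Q - P; the bound M is what places it in the algebra, as the
    order requires. *)
Lemma Linf_le_intro (P Q : R -> R) (M : R) :
  measurable_fun I P -> measurable_fun I Q ->
  {ae mu, forall x, I x -> P x <= Q x} ->
  {ae mu, forall x, I x -> Q x - P x <= M} ->
  Linf_le c (fun x => (P x)%:C) (fun x => (Q x)%:C).
Proof.
move=> mP mQ PQ hM; exists (fun x => (Num.sqrt (Q x - P x))%:C).
  apply/LinfP; split.
    apply: cmeasurable_real.
    exact: (measurableT_comp (continuous_measurable_fun (@sqrt_continuous R))
      (measurable_funB mQ mP)).
  exists M; apply: (ae_imp2 PQ hM) => x h1 h2 Ix.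
  by rewrite sqmod_real sqr_sqrtr ?subr_ge0 ?h1// h2.
apply: (ae_imp PQ) => x h1 Ix; rewrite mulrC mulC_conj sqmod_real sqr_sqrtr.
  by rewrite -rmorphB.
by rewrite subr_ge0 h1.
Qed.

Section family.
Variable q : int -> R -> R.
Hypotheses (mq : forall n, measurable_fun I (q n)) (q0 : forall n x, 0 <= q n x).
Let S x : \bar R := (\esum_(n in [set: int]) (q n x)%:E)%E.

Let S0 x : (0 <= S x)%E.
Proof. by apply: esum_ge0 => n _; rewrite lee_fin. Qed.

Let mS : measurable_fun I S.
Proof.
apply: measurable_esum => [n x|n]; first by rewrite lee_fin.
exact/measurable_EFinP.
Qed.

Lemma fsum_le_esum (F : {fset int}) x : ((\sum_(n <- F) q n x)%:E <= S x)%E.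
Proof.
rewrite -sumEFin; apply: esum_ge; exists [set` F]; first by split.
by rewrite fsbig_finite//= set_fsetK.
Qed.

Lemma fsum_subset (F F' : {fset int}) x : (F `<=` F')%fset ->
  \sum_(n <- F) q n x <= \sum_(n <- F') q n x.
Proof.
move=> FF'; rewrite -lee_fin -!sumEFin.
by apply: lee_sum_nneg_subfset => [n nF|n _ _]; rewrite ?lee_fin// (fsubsetP FF').
Qed.

(** An increasing sequence of finite sets exhausting Z, through which convergence theorems for
    sequences reach the net of all finite subsets. *)
Definition nu_fset (N : nat) : {fset int} := [fset nu k | k in iota 0 N]%fset.

Lemma sum_nu_fset N x : \sum_(n <- nu_fset N) q n x = \sum_(0 <= k < N) q (nu k) x.
Proof.
rewrite big_imfset/=; last first.
  by move=> k l _ _; have [_ inj _] := nu_bij; apply: inj; rewrite inE.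
by rewrite undup_id ?iota_uniq// /index_iota subn0.
Qed.

Lemma nu_fset_cvg x : S x \is a fin_num ->
  \sum_(n <- nu_fset N) q n x @[N --> \oo] --> fine (S x).
Proof.
move=> Sx; under eq_fun do rewrite sum_nu_fset.
have : (\sum_(0 <= k < N) (q (nu k) x)%:E)%E @[N --> \oo] --> S x.
  rewrite /S esum_nu; last by move=> n; rewrite lee_fin.
  by apply: is_cvg_nneseries => k _ _; rewrite lee_fin.
rewrite -(fineK Sx) => /fine_cvgP[_].
by under eq_fun do rewrite /= sumEFin/=.
Qed.

(** Along [nu_fset] the error tends to 0 by dominated convergence, with bound M^2 |h|^2. Since the
    terms are nonnegative, enlarging the finite set only brings the partial sum closer to S, which
    handles the whole net. *)
Lemma strong_sum_intro (M : R) : {ae mu, forall x, I x -> (S x <= M%:E)%E} ->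
  strong_sum c (fun n x => (q n x)%:C) (fun x => (fine (S x))%:C).
Proof.
move=> SM.
have Sfin x : (S x <= M%:E)%E -> S x \is a fin_num.
  by move=> h; rewrite ge0_fin_numE//; apply: le_lt_trans h (ltry _).
have mfS : measurable_fun I (fun x => fine (S x)).
  exact: (@measurableT_comp _ _ _ _ _ _ fine).
have LS : Linf c (fun x => (fine (S x))%:C).
  apply/LinfP; split; first exact: cmeasurable_real.
  exists (M ^+ 2); apply: (ae_imp SM) => x h Ix; have {}h := h Ix.
  rewrite sqmod_real ler_sqr ?nnegrE ?fine_ge0//.
    by rewrite -lee_fin fineK ?Sfin.
  by rewrite -lee_fin; exact: le_trans h.
split; [|exact: LS|].
- move=> n; apply/LinfP; split; first exact: cmeasurable_real.
  exists (M ^+ 2); apply: (ae_imp SM) => x h Ix; have {}h := h Ix.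
  have qM : q n x <= M.
    rewrite -lee_fin; apply: le_trans h.
    by apply: esum_ge_term => k; rewrite lee_fin.
  by rewrite sqmod_real ler_sqr ?nnegrE// (le_trans (q0 n x)).
move=> h hh e e0.
pose D N x : \bar R := (sqmod (\sum_(n <- nu_fset N) (q n x)%:C * h x - (fine (S x))%:C * h x))%:E.
have DE F x : sqmod (\sum_(n <- F) (q n x)%:C * h x - (fine (S x))%:C * h x)
    = (\sum_(n <- F) q n x - fine (S x)) ^+ 2 * sqmod (h x).
  by rewrite -mulr_suml -mulrBl sqmodM -rmorph_sum -rmorphB sqmod_real.
have mD F : measurable_fun I (fun x => (sqmod (\sum_(n <- F) (q n x)%:C * h x - (fine (S x))%:C * h x))%:E).
  rewrite (_ : (fun x => _) = fun x =>
      ((\sum_(n <- F) q n x - fine (S x)) ^+ 2 * sqmod (h x))%:E); last first.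
    by apply/funext => x; rewrite DE.
  apply/measurable_EFinP; apply: measurable_funM.
    by apply: measurable_funX; apply: measurable_funB => //; exact: measurable_sum.
  exact: measurable_sqmod hh.1.
have [] := @dominated_convergence _ _ _ mu I mI D (cst 0%E)
    (fun x => ((M ^+ 2)%:E * (sqmod (h x))%:E)%E) (fun N => mD _) (measurable_cst _).
- apply: (ae_imp SM) => x Sx Ix; rewrite /D.
  rewrite (_ : (fun N => _) = fun N =>
      ((\sum_(n <- nu_fset N) q n x - fine (S x)) ^+ 2 * sqmod (h x))%:E); last first.
    by apply/funext => N; rewrite DE.
  apply: cvg_EFin; first exact: nearW.
  rewrite (_ : _ \o _ = fun N => (\sum_(n <- nu_fset N) q n x - fine (S x)) *
      (\sum_(n <- nu_fset N) q n x - fine (S x)) * sqmod (h x)); last first.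
    by apply/funext => N /=; rewrite expr2.
  have cv := nu_fset_cvg (Sfin _ (Sx Ix)).
  have c1 : \sum_(n <- nu_fset N) q n x - fine (S x) @[N --> \oo] --> (0 : R).
    rewrite -[X in _ --> X](subrr (fine (S x))).
    by apply: cvgB; [exact: cv|exact: cvg_cst].
  rewrite -[X in _ --> X](mul0r (sqmod (h x))); apply: cvgM; last exact: cvg_cst.
  by rewrite -[X in _ --> X](mul0r 0); apply: cvgM; exact: c1.
- apply: (integrableZl (mu := mu) mI); exact: L2_integrable.
- apply: (ae_imp SM) => x Sx N Ix; rewrite /D DE gee0_abs; last first.
    by rewrite lee_fin mulr_ge0 ?sqr_ge0 ?sqmod_ge0.
  rewrite -EFinM lee_fin ler_wpM2r ?sqmod_ge0//.
  have Sf := Sfin _ (Sx Ix).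
  have h1 : \sum_(n <- nu_fset N) q n x <= fine (S x).
    by rewrite -lee_fin fineK//; exact: fsum_le_esum.
  have h2 : fine (S x) <= M by rewrite -lee_fin fineK// Sx.
  have h3 : 0 <= \sum_(n <- nu_fset N) q n x by rewrite sumr_ge0.
  by rewrite -sqrrN opprB ler_sqr ?nnegrE ?subr_ge0//; lra.
move=> _ _; rewrite integral0 => /fine_cvgP[fD].
have e20 : 0 < e ^+ 2 by rewrite exprn_gt0.
move=> /cvgr0_norm_lt/(_ _ e20) cD.
have [N [fN hN]] : exists N, (\int[mu]_(x in I) D N x)%E \is a fin_num /\
    fine (\int[mu]_(x in I) D N x)%E < e ^+ 2.
  have [N1 _ h1] := fD; have [N2 _ h2] := cD.
  exists (maxn N1 N2); split; first exact: (h1 _ (leq_maxl _ _)).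
  apply: le_lt_trans (h2 _ (leq_maxr _ _)).
  exact: ler_norm.
exists (nu_fset N) => F FN; apply: (@le_lt_trans _ _ (\int[mu]_(x in I) D N x)%E); last first.
  by rewrite -(fineK fN) lte_fin.
apply: ae_ge0_le_integral => //.
- by move=> x _; rewrite lee_fin sqmod_ge0.
- exact: mD.
- by move=> x _; rewrite lee_fin sqmod_ge0.
- exact: mD.
apply: (ae_imp SM) => x Sx Ix; rewrite /D !DE lee_fin ler_wpM2r ?sqmod_ge0//.
have Sf := Sfin _ (Sx Ix).
have h1 : \sum_(n <- F) q n x <= fine (S x).
  by rewrite -lee_fin fineK//; exact: fsum_le_esum.
have h2 := fsum_subset x FN.
rewrite -sqrrN opprB -[leRHS]sqrrN opprB ler_sqr ?nnegrE ?subr_ge0//; lra.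
Qed.

(** Strong convergence tested on the constant function 1 is convergence of the partial sums to s in
    L^2[0, c]. The two inequalities between S and Re s are proved apart, each by showing that the
    positive part of a difference has norm 0. *)
Lemma strong_sum_elim (s : R -> R[i]) :
  strong_sum c (fun n x => (q n x)%:C) s ->
  {ae mu, forall x, I x -> S x = (complex.Re (s x))%:E}.
Proof.
move=> [_ /LinfP[ms _] hs].
pose t x := complex.Re (s x).
have mt : measurable_fun I t by exact: ms.1.
have DE (F : seq int) x : sqmod (\sum_(n <- F) (q n x)%:C * 1 - s x * 1) =
    (\sum_(n <- F) q n x - t x) ^+ 2 + complex.Im (s x) ^+ 2.
  by rewrite -mulr_suml !mulr1 -rmorph_sum /sqmod !ReImE /= sub0r sqrrN.
have mF (F : seq int) : measurable_fun I (fun x => (\sum_(n <- F) q n x - t x) ^+ 2).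
  by apply: measurable_funX; apply: measurable_funB => //; exact: measurable_sum.
have hs1 (e : R) : 0 < e -> exists F0 : {fset int}, forall F : {fset int}, (F0 `<=` F)%fset ->
    (\int[mu]_(x in I) ((\sum_(n <- F) q n x - t x) ^+ 2)%:E < (e ^+ 2)%:E)%E.
  move=> e0; have [F0 hF0] := hs _ (L2_1 c0) e e0; exists F0 => F FF.
  apply: le_lt_trans (hF0 F FF); apply: ge0_le_integral => //.
  - by move=> x _; rewrite lee_fin sqr_ge0.
  - by apply/measurable_EFinP; exact: mF.
  - rewrite (_ : (fun x => _) = fun x =>
        ((\sum_(n <- F) q n x - t x) ^+ 2 + complex.Im (s x) ^+ 2)%:E); last first.
      by apply/funext => x; rewrite DE.
    apply/measurable_EFinP; apply: measurable_funD; first exact: mF.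
    by apply: measurable_funX; exact: ms.2.
  - by move=> x _; rewrite lee_fin DE lerDl sqr_ge0.
have key (w : R -> R) : measurable_fun I w ->
    (forall e : R, 0 < e -> (\int[mu]_(x in I) ((w x) ^+ 2)%:E < (e ^+ 2)%:E)%E) ->
    {ae mu, forall x, I x -> w x = 0}.
  move=> mw hw; have mw2 : measurable_fun I (fun x => ((w x) ^+ 2)%:E).
    by apply/measurable_EFinP; exact: measurable_funX.
  have w0 : (\int[mu]_(x in I) ((w x) ^+ 2)%:E = 0)%E.
    have : (0 <= \int[mu]_(x in I) ((w x) ^+ 2)%:E)%E.
      by apply: integral_ge0 => x _; rewrite lee_fin sqr_ge0.
    move: hw; case: (\int[mu]_(x in I) _)%E => [r| |]//; last first.
      by move=> /(_ 1 ltr01).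
    move=> hr; rewrite lee_fin le_eqVlt => /predU1P[<-//|r0].
    have := hr (Num.sqrt r); rewrite sqrtr_gt0 sqr_sqrtr ?ltW// => /(_ r0).
    by rewrite lte_fin ltxx.
  have := (ae_eq_integral_abs mu mI mw2).1.
  under eq_integral do rewrite gee0_abs ?lee_fin ?sqr_ge0//.
  move=> /(_ w0) h; apply: (ae_imp h) => x {}h Ix.
  by have := h Ix => -[] /eqP; rewrite sqrf_eq0 => /eqP.
(* A nonnegative w dominated by the error of every sufficiently large finite set has arbitrarily
   small norm. *)
have le_key (w : R -> R) : measurable_fun I w -> (forall x, 0 <= w x) ->
    (exists F1 : {fset int}, forall F : {fset int}, (F1 `<=` F)%fset ->
      {ae mu, forall x, I x -> w x <= `|\sum_(n <- F) q n x - t x|}) ->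
    {ae mu, forall x, I x -> w x = 0}.
  move=> mw w0 [F1 hw]; apply: key => // e e0; have [F0 hF0] := hs1 e e0.
  apply: le_lt_trans (hF0 (F0 `|` F1)%fset (fsubsetUl _ _)).
  apply: ae_ge0_le_integral => //.
  - by move=> x _; rewrite lee_fin sqr_ge0.
  - by apply/measurable_EFinP; exact: measurable_funX.
  - by move=> x _; rewrite lee_fin sqr_ge0.
  - by apply/measurable_EFinP; exact: mF.
  apply: (ae_imp (hw (F0 `|` F1)%fset (fsubsetUr _ _))) => x h Ix.
  by rewrite lee_fin -[leRHS]real_normK ?num_real// ler_sqr ?nnegrE// h.
have max0E (y : R) : Num.max y 0 = 0 -> y <= 0.
  by move=> <-; rewrite le_max lexx.
have upper (N : nat) : {ae mu, forall x, I x -> \sum_(n <- nu_fset N) q n x <= t x}.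
  have mw : measurable_fun I (fun x => Num.max (\sum_(n <- nu_fset N) q n x - t x) 0).
    apply: measurable_maxr; last exact: measurable_cst.
    by apply: measurable_funB => //; exact: measurable_sum.
  have w0 x : 0 <= Num.max (\sum_(n <- nu_fset N) q n x - t x) 0.
    by rewrite le_max lexx orbT.
  apply: (ae_imp (le_key _ mw w0 _)); last first.
    by move=> x h Ix; rewrite -subr_le0; apply: max0E; exact: h.
  exists (nu_fset N) => F FN; apply/aeW => x Ix; rewrite ge_max normr_ge0 andbT.
  by apply: le_trans (ler_norm _); rewrite lerD2r; exact: fsum_subset.
have St : {ae mu, forall x, I x -> (S x <= (t x)%:E)%E}.
  apply: (ae_imp (ae_foralln upper)) => x h Ix.
  rewrite /S esum_nu; last by move=> n; rewrite lee_fin.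
  apply: lime_le; first by apply: is_cvg_nneseries => k _ _; rewrite lee_fin.
  by apply: nearW => N; rewrite sumEFin lee_fin -sum_nu_fset h.
have mw : measurable_fun I (fun x => Num.max (t x - fine (S x)) 0).
  apply: measurable_maxr; last exact: measurable_cst.
  apply: measurable_funB => //.
  exact: (@measurableT_comp _ _ _ _ _ _ fine).
have w0 x : 0 <= Num.max (t x - fine (S x)) 0 by rewrite le_max lexx orbT.
apply: (ae_imp2 St (le_key _ mw w0 _)).
  (* Partial sums stay below S, so the excess of t over S is below the error for every finite set,
     starting from the empty one. *)
  exists fset0 => F _; apply: (ae_imp St) => x Sx Ix.
  rewrite ge_max normr_ge0 andbT distrC; apply: le_trans (ler_norm _).
  rewrite lerD2l lerN2 -lee_fin fineK; first exact: fsum_le_esum.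
  by rewrite ge0_fin_numE//; apply: le_lt_trans (Sx Ix) (ltry _).
move=> x Sx h Ix.
have Sf : S x \is a fin_num.
  by rewrite ge0_fin_numE//; apply: le_lt_trans (Sx Ix) (ltry _).
apply/eqP; rewrite eq_le Sx//= -(fineK Sf) lee_fin -subr_le0.
by apply: max0E; exact: h.
Qed.

End family.
End strong_sums.

(** * Modulations of a family against its module inequalities *)

Section family.
Context {R : realType}.
Variables b c : R.
Hypotheses (b0 : 0 < b) (c0 : 0 < c) (bc : b * c = 1).
Local Notation mu := (@lebesgue_measure R).
Local Notation I := `[0, c]%classic.
Local Notation ip := (Linf_l2_inner c).
Implicit Types (f h : R -> R[i]).
(** For [u n] the translate of g by na, the families [v] and [G] below unfold to the module sequence
    and the Gabor system of the theorem. *)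
Variable u : int -> R -> R[i].
Hypothesis hu : forall n, L2 [set: R] (u n).

Let v (n : int) : R -> R[i] := fun x => (1 / Num.sqrt b)%:C * u n x.
Let G (mn : int * int) : R -> R[i] := modulation (mn.1%:~R * b) (u mn.2).
Let a f (m n : int) : \bar R := (sqmod (L2inner [set: R] f (G (m, n))))%:E.

Let mI : measurable I. Proof. exact: measurable_itv. Qed.

Let hv n : L2 [set: R] (v n). Proof. exact: L2Z. Qed.

Lemma L2_mod_family mn : L2 [set: R] (G mn).
Proof. exact: L2_modulation. Qed.

(** [G (m, n)] is sqrt b times a modulation of [v n]; squaring yields a factor b, which cancels the
    factor c of Parseval. *)
Lemma esum_mod_family f n : L2 [set: R] f -> L2 I (ip f (v n)) ->
  (\esum_(m in [set: int]) a f m n = L2norm_sq I (ip f (v n)))%E.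
Proof.
move=> hf hfv; transitivity (b%:E * (c%:E * L2norm_sq I (ip f (v n))))%E; last first.
  by rewrite muleA -EFinM bc mul1e.
rewrite -(parseval_bracket c0 bc hf (hv n) hfv) -esumZl ?ltW//; last first.
  by move=> m; rewrite lee_fin sqmod_ge0.
apply: eq_esum => m _; rewrite /a -EFinM; congr EFin.
have sb : Num.sqrt b != 0 by rewrite gt_eqF// sqrtr_gt0.
have -> : G (m, n) = fun x => (Num.sqrt b)%:C * modulation (m%:~R * b) (v n) x.
  have sr : (Num.sqrt b)%:C * (1 / Num.sqrt b)%:C = 1 :> R[i].
    by rewrite -rmorphM/= mul1r mulfV.
  apply/funext => x; rewrite /G /modulation /v /=.
  by rewrite [RHS]mulrCA [X in _ = _ * X]mulrA sr mul1r.
rewrite L2inner_Zr//; last exact: L2_modulation.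
by rewrite sqmodM sqmodC sqmod_real sqr_sqrtr// ltW.
Qed.

Lemma esum_pair f : (\esum_(mn in [set: int * int])
    (sqmod (L2inner [set: R] f (G mn)))%:E =
  \esum_(n in [set: int]) \esum_(m in [set: int]) a f m n)%E.
Proof.
rewrite esum_esum; last by move=> i j _ _; rewrite lee_fin sqmod_ge0.
rewrite (_ : _ `*`` _ = [set: int * int]); last by apply/seteqP; split.
apply: (@reindex_esum _ _ _ _ _ (fun mn : int * int => (mn.2, mn.1))).
split => // [[m n] [m' n'] _ _ [-> ->]//|[m n] _].
by exists (n, m).
Qed.

Definition bracket_sum f x : \bar R :=
  (\esum_(n in [set: int]) (sqmod (ip f (v n) x))%:E)%E.

Lemma bracket_sum_ge0 f x : (0 <= bracket_sum f x)%E.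
Proof. by apply: esum_ge0 => n _; rewrite lee_fin sqmod_ge0. Qed.

Lemma measurable_bracket_sum D f : cmeasurable [set: R] f ->
  measurable_fun D (bracket_sum f).
Proof.
move=> mf; apply: measurable_esum => [n x|n]; first by rewrite lee_fin sqmod_ge0.
by apply: measurable_sqmodE; apply: measurable_bracket => //; exact: (hv n).1.
Qed.

(** By Cauchy-Schwarz the squared bracket is at most <h,h> <f,f>, where <h,h> is bounded and <f,f>
    is integrable over the period. *)
Lemma L2_bracket f h : L2 [set: R] f -> Linf_l2 c h -> L2 I (ip f h).
Proof.
move=> hf /Linf_l2P[mh [M hM]]; have mip := measurable_bracket c I hf.1 mh.
split => //; apply: (@le_lt_trans _ _ (\int[mu]_(x in I) (`|M|%:E * persq c f x))%E).
  apply: ae_ge0_le_integral => //.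
  - by move=> x _; rewrite lee_fin sqmod_ge0.
  - exact: measurable_sqmodE.
  - by move=> x _; rewrite mule_ge0// persq_ge0.
  - by apply: measurable_funeM; exact: measurable_persq hf.1.
  apply: (ae_imp2 hM (persq_ae_fin c0 hf)) => x hx fx Ix.
  have hfin : persq c h x \is a fin_num.
    by rewrite ge0_fin_numE ?persq_ge0//; apply: le_lt_trans (hx Ix) _; exact: ltry.
  rewrite -(fineK (fx Ix)) -EFinM lee_fin.
  apply: (le_trans (bracket_CS (fx Ix) hfin)).
  rewrite mulrC ler_wpM2r ?fine_ge0 ?persq_ge0// -lee_fin fineK//.
  by apply: (le_trans (hx Ix)); rewrite lee_fin ler_norm.
rewrite ge0_integralZl//.
- rewrite integral_persq//; last exact: hf.1.
  by rewrite L2nE// -EFinM ltry.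
- exact: measurable_persq hf.1.
- by move=> x _; exact: persq_ge0.
Qed.

Lemma esum_family_bracket f : (forall n, Linf_l2 c (v n)) -> L2 [set: R] f ->
  (\esum_(mn in [set: int * int]) (sqmod (L2inner [set: R] f (G mn)))%:E =
   \int[mu]_(x in I) bracket_sum f x)%E.
Proof.
move=> vL hf; rewrite esum_pair /bracket_sum integral_esum//.
- by apply: eq_esum => n _; rewrite esum_mod_family//; exact: L2_bracket.
- by move=> n x; rewrite lee_fin sqmod_ge0.
- move=> n; apply: measurable_sqmodE; apply: measurable_bracket.
    exact: hf.1.
  exact: (hv n).1.
Qed.

(** The indicator of one period has squared norm c > 0, and a sum of squares bounded by B c forces B
    >= 0. *)
Lemma bessel_ge0 B : bessel [set: R] G B -> 0 <= B.
Proof.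
move=> [_ hB]; pose f : R -> R[i] := fun x => (\1_I x)%:C.
have E : L2norm_sq [set: R] f = c%:E.
  rewrite /L2norm_sq -(measure_period c0) -[in RHS](setIT I) -integral_indic//.
  apply: eq_integral => x _; rewrite sqmod_real indicE.
  by case: (x \in _); rewrite ?expr1n ?expr0n.
have hf : L2 [set: R] f.
  split; last by rewrite E ltry.
  by apply: cmeasurable_real; exact: measurable_indic.
have := hB _ hf; rewrite E -EFinM => h.
rewrite -(pmulr_lge0 _ c0) -lee_fin; apply: le_trans h.
by apply: esum_ge0 => k _; rewrite lee_fin sqmod_ge0.
Qed.

(** Let p = <v_n,v_n>, not yet known to be bounded. On a periodic set where p <= N the bracket of
    the cut v_n with v_n is p itself, which is bounded there, so Parseval applies and the Bessel
    inequality yields p^2 <= B p. As N grows these sets exhaust the points where p is finite. *)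
Lemma bessel_Linf_l2 B n : bessel [set: R] G B -> Linf_l2 c (v n).
Proof.
move=> hB; have B0 := bessel_ge0 hB; have [_ hB'] := hB.
have mv (D : set R) : measurable_fun D (persq c (v n)).
  exact: measurable_persq (hv n).1.
have step (N : nat) : {ae mu, forall x, `[0, c[%classic x ->
    (persq c (v n) x <= N%:R%:E -> persq c (v n) x <= B%:E)%E}.
  pose Z := [set x | (persq c (v n) x <= N%:R%:E)%E].
  have mZ : measurable Z.
    by rewrite -[Z]setTI; apply: measurable_lee => //; exact: measurable_cst.
  have pZ : periodic c Z by move=> k x; rewrite /Z /= persq_period.
  (* The two sides p^2 and B p on Z, to be compared through integrals over arbitrary subsets of [0,
     c[. *)
  pose U x : \bar R := ((\1_Z x)%:E * ((fine (persq c (v n) x)) ^+ 2)%:E)%E.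
  pose V x : \bar R := (B%:E * ((\1_Z x)%:E * persq c (v n) x))%E.
  have mUV (D : set R) : measurable_fun D U /\ measurable_fun D V.
    have m1 : measurable_fun D (fun x => (\1_Z x : R)%:E).
      by apply/measurable_EFinP; apply: measurable_funTS; exact: measurable_indic.
    split; last by apply: measurable_funeM; exact: emeasurable_funM.
    apply: emeasurable_funM => //; apply/measurable_EFinP; apply: measurable_funX.
    exact: (@measurableT_comp _ _ _ _ _ _ fine).
  have UV := @ae_le_of_integral_le R `[0, c[%classic U V _ (mUV _).1 (mUV _).2.
  suff : {ae mu, forall x, `[0, c[%classic x -> (U x <= V x)%E}.
    move=> h; apply: (ae_imp h) => x {}h Ix Zx; have := h Ix.
    have fx : persq c (v n) x \is a fin_num.
      by rewrite ge0_fin_numE ?persq_ge0//; apply: le_lt_trans Zx _; exact: ltry.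
    rewrite /U /V indicE mem_set// !mul1e -(fineK fx) -EFinM !lee_fin expr2.
    have := fine_ge0 (persq_ge0 c (v n) x).
    rewrite le_eqVlt => /predU1P[<-|fp]; first by [].
    by rewrite ler_pM2r.
  apply: UV => //.
  - by move=> x; rewrite mule_ge0// lee_fin ?sqr_ge0.
  - by move=> x; rewrite mule_ge0// mule_ge0// persq_ge0.
  - apply: (@le_lt_trans _ _ (\int[mu]_(x in `[0%R, c[) (B%:E * persq c (v n) x))%E).
      apply: ge0_le_integral => //.
      + by move=> x _; rewrite mule_ge0// mule_ge0// persq_ge0.
      + exact: (mUV _).2.
      + by apply: measurable_funeM; exact: mv.
      + move=> x _; rewrite lee_wpmul2l// indicE.
        by case: (_ \in _); rewrite ?mul1e// mul0e persq_ge0.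
    rewrite ge0_integralZl//; first last.
    - by move=> x _; exact: persq_ge0.
    - exact: mv.
    rewrite integral_itv_bndo_bndc; last exact: mv.
    by rewrite integral_persq ?L2nE// -?EFinM ?ltry//; exact: (hv n).1.
  move=> E mE Ec.
  pose Z' := Z `&` periodize c E.
  have mZ' : measurable Z' by apply: measurableI => //; exact: measurable_periodize.
  have pZ' : periodic c Z'.
    by move=> k x; rewrite /Z' /setI /= pZ (periodic_periodize c0).
  have hf := L2_cut mZ' (hv n).
  have ipE x : ip (cut Z' (v n)) (v n) x = (\1_Z' x * fine (persq c (v n) x))%:C.
    by rewrite bracket_cut// bracket_self rmorphM.
  have hip : L2 I (ip (cut Z' (v n)) (v n)).
    rewrite (funext ipE); apply: (@L2_le_bounded _ _ c0 _ (N%:R ^+ 2)).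
      apply: measurable_funM; first by apply: measurable_funTS; exact: measurable_indic.
      exact: (@measurableT_comp _ _ _ _ _ _ fine).
    move=> x _; rewrite indicE; have [|] := boolP (x \in Z').
      rewrite inE => -[Zx _]; rewrite mul1r ler_sqr ?nnegrE ?fine_ge0 ?persq_ge0//.
      have fx : persq c (v n) x \is a fin_num.
        by rewrite ge0_fin_numE ?persq_ge0//; apply: le_lt_trans Zx _; exact: ltry.
      by rewrite -lee_fin fineK.
    by rewrite mul0r expr0n/= sqr_ge0.
  have a0 k : (0 <= \esum_(m in [set: int]) a (cut Z' (v n)) m k)%E.
    by apply: esum_ge0 => m _; rewrite lee_fin sqmod_ge0.
  (* Of the double sum only the row of index n is kept: it is the one whose bracket is under
     control. *)
  have := hB' _ hf; rewrite esum_pair => /(le_trans (esum_ge_term n a0)).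
  rewrite esum_mod_family// -(integral_persq c0 hf.1) => h.
  rewrite -(integral_period_indic c0 (F := U) mE Ec (mUV _).1).
  rewrite -(integral_period_indic c0 (F := V) mE Ec (mUV _).2).
  have Z'E x : \1_Z' x = \1_(periodize c E) x * \1_Z x :> R.
    by rewrite indicI mulrC.
  have <- : L2norm_sq I (ip (cut Z' (v n)) (v n)) =
      (\int[mu]_(x in I) ((\1_(periodize c E) x)%:E * U x))%E.
    apply: eq_integral => x _; rewrite ipE sqmod_real Z'E -mulrA /U -!EFinM.
    rewrite exprMn; congr (_ * _)%:E.
      by rewrite indicE; case: (_ \in _); rewrite ?expr1n ?expr0n.
    rewrite exprMn; congr (_ * _).
    by rewrite indicE; case: (_ \in _); rewrite ?expr1n ?expr0n.
  apply: (le_trans h); rewrite -ge0_integralZl//; first last.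
  - by move=> x _; exact: persq_ge0.
  - exact: measurable_persq hf.1.
  rewrite le_eqVlt; apply/orP; left; apply/eqP/eq_integral => x _.
  rewrite persq_cut// Z'E /V EFinM.
  by rewrite !muleA [(B%:E * (\1_(periodize c E) x)%:E)%E]muleC.
apply/Linf_l2P; split; first exact: (hv n).1.
exists B; apply: ae_period.
apply: (ae_imp2 (ae_foralln step) (persq_ae_fin c0 (hv n))) => x h fx Ix.
have {}fx : persq c (v n) x \is a fin_num.
  by apply: fx; move: Ix; rewrite /= !in_itv/= => /andP[-> /ltW ->].
(* The bounds for all N hold off a common null set, so N may depend on the point. *)
apply: (h (Num.truncn (fine (persq c (v n) x))).+1 Ix).
rewrite -(fineK fx) lee_fin; apply: ltW; exact: truncnS_gt.
Qed.

Lemma Linf_l2_L2 f : Linf_l2 c f -> L2 [set: R] f.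
Proof.
move=> /Linf_l2P[mf [M hM]]; split => //.
rewrite -(integral_persq c0 mf).
apply: (@le_lt_trans _ _ (\int[mu]_(x in I) (`|M|%:E))%E).
  apply: ae_ge0_le_integral => //.
  - by move=> x _; exact: persq_ge0.
  - exact: measurable_persq.
  apply: (ae_imp hM) => x h Ix; apply: (le_trans (h Ix)).
  by rewrite lee_fin ler_norm.
by rewrite integral_cst//= (measure_period c0) -EFinM ltry.
Qed.

Lemma bracket_sum_cut Z f x : periodic c Z ->
  bracket_sum (cut Z f) x = ((\1_Z x)%:E * bracket_sum f x)%E.
Proof.
move=> pZ; rewrite /bracket_sum -esumZl//; last by move=> n; rewrite lee_fin sqmod_ge0.
apply: eq_esum => n _; rewrite bracket_cut// sqmodM sqmod_real EFinM.
by congr (_%:E * _)%E; rewrite indicE; case: (x \in Z); rewrite ?expr1n ?expr0n.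
Qed.

(** * Localization of the inequalities and normalization *)

Section linf_family.
Hypothesis vL : forall n, Linf_l2 c (v n).

Lemma cut_energy f E : L2 [set: R] f -> measurable E -> E `<=` `[0, c[%classic ->
  (\esum_(mn in [set: int * int])
     (sqmod (L2inner [set: R] (cut (periodize c E) f) (G mn)))%:E
   = \int[mu]_(x in E) bracket_sum f x)%E /\
  (L2norm_sq [set: R] (cut (periodize c E) f) = \int[mu]_(x in E) persq c f x)%E.
Proof.
move=> hf mE Ec; have pE := periodic_periodize c0 E.
have hcf := L2_cut (measurable_periodize c0 mE) hf; split.
- rewrite (esum_family_bracket vL hcf).
  under eq_integral do rewrite bracket_sum_cut//.
  by rewrite integral_period_indic//; exact: measurable_bracket_sum hf.1.
- rewrite -(integral_persq c0 hcf.1).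
  under eq_integral do rewrite persq_cut//.
  by rewrite integral_period_indic//; exact: measurable_persq hf.1.
Qed.

Lemma integral_persq_sub f E : L2 [set: R] f -> measurable E -> E `<=` `[0, c[%classic ->
  (\int[mu]_(x in E) persq c f x < +oo)%E.
Proof.
move=> hf mE Ec; have [_ <-] := cut_energy hf mE Ec.
by have [_] := L2_cut (measurable_periodize c0 mE) hf.
Qed.

Lemma bessel_ae B f : bessel [set: R] G B -> L2 [set: R] f ->
  {ae mu, forall x, I x -> (bracket_sum f x <= B%:E * persq c f x)%E}.
Proof.
move=> hB hf; have B0 := bessel_ge0 hB.
have mp (D : set R) : measurable_fun D (persq c f) by exact: measurable_persq hf.1.
have ZL (D : set R) : measurable D -> (\int[mu]_(x in D) (B%:E * persq c f x) =
    B%:E * \int[mu]_(x in D) persq c f x)%E.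
  move=> mD; rewrite ge0_integralZl//; last by move=> x _; exact: persq_ge0.
  exact: mp.
apply/ae_period/ae_le_of_integral_le => //.
- exact: measurable_bracket_sum hf.1.
- by apply: measurable_funeM; exact: mp.
- exact: bracket_sum_ge0.
- by move=> x; rewrite mule_ge0// persq_ge0.
- by rewrite ZL// lte_mul_pinfty//; exact: integral_persq_sub.
move=> E mE Ec; rewrite ZL//; have [<- <-] := cut_energy hf mE Ec.
by apply: hB.2; exact: L2_cut (measurable_periodize c0 mE) hf.
Qed.

Lemma frame_ae A B f : frame [set: R] G A B -> L2 [set: R] f ->
  {ae mu, forall x, I x -> (A%:E * persq c f x <= bracket_sum f x)%E}.
Proof.
move=> [A0 B0 hB hA] hf.
have mp (D : set R) : measurable_fun D (persq c f) by exact: measurable_persq hf.1.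
have ZL (D : set R) : measurable D -> (\int[mu]_(x in D) (A%:E * persq c f x) =
    A%:E * \int[mu]_(x in D) persq c f x)%E.
  move=> mD; rewrite ge0_integralZl//; first last.
  - by rewrite lee_fin ltW.
  - by move=> x _; exact: persq_ge0.
  - exact: mp.
apply/ae_period/ae_le_of_integral_le => //.
- by apply: measurable_funeM; exact: mp.
- exact: measurable_bracket_sum hf.1.
- by move=> x; rewrite mule_ge0 ?persq_ge0// lee_fin ltW.
- exact: bracket_sum_ge0.
(* The comparison lemma wants the larger side integrable. Here that is the bracket sum, whose
   integral is finite by the Bessel bound on the whole period. *)
- have Ec := @subset_refl _ `[0, c[%classic.
  have mE : measurable `[0, c[%classic by exact: measurable_itv.
  have [<- h2] := cut_energy hf mE Ec.
  have hcf := L2_cut (measurable_periodize c0 mE) hf.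
  apply: (le_lt_trans (hB.2 _ hcf)); rewrite h2 lte_mul_pinfty ?lee_fin ?ltW//.
  exact: integral_persq_sub.
move=> E mE Ec; rewrite ZL//; have [<- <-] := cut_energy hf mE Ec.
by apply: hA; exact: L2_cut (measurable_periodize c0 mE) hf.
Qed.

(* [f'] is [f] divided by the square root of its periodized square modulus. *)
Lemma normalize_Linf_l2 f : L2 [set: R] f -> exists2 f', Linf_l2 c f' &
  {ae mu, forall x, I x -> exists2 w : R, 0 <= w &
    bracket_sum f x = (w%:E * bracket_sum f' x)%E /\
    persq c f x = (w%:E * persq c f' x)%E}.
Proof.
move=> hf; pose r x := fine (persq c f x) `^ (- 2^-1).
have r2 x : persq c f x \is a fin_num -> fine (persq c f x) != 0 ->
    (r x) ^+ 2 = (fine (persq c f x))^-1.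
  move=> fx w0; have wp : 0 <= fine (persq c f x) by apply/fine_ge0/persq_ge0.
  rewrite /r -powR_mulrn ?powR_ge0// -powRrM mulNr mulVf ?pnatr_eq0//.
  by rewrite powR_inv1.
(* The convention that 0 to a nonzero power is 0 makes f' vanish where <f,f> is 0, and also where it
   is infinite, so the bound <f',f'> <= 1 holds everywhere. *)
have r0 x : fine (persq c f x) = 0 -> r x = 0.
  by move=> h; rewrite /r h powR0// oppr_eq0 invr_eq0 pnatr_eq0.
have rk x (k : int) : r (x - k%:~R * c) = r x by rewrite /r persq_period.
pose f' x := (r x)%:C * f x.
have mf' : cmeasurable [set: R] f'.
  apply: cmeasurableM; last exact: hf.1.
  apply: cmeasurable_real.
  apply: (@measurableT_comp _ _ _ _ _ _ (@powR R ^~ (- 2^-1))).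
    exact: measurable_powR.
  apply: (@measurableT_comp _ _ _ _ _ _ fine) => //.
  exact: measurable_persq hf.1.
have persqE x : persq c f' x = ((r x ^+ 2)%:E * persq c f x)%E.
  rewrite /persq -esumZl ?sqr_ge0//; last by move=> k; rewrite lee_fin sqmod_ge0.
  by apply: eq_esum => k _; rewrite /f' rk sqmodM sqmod_real EFinM.
exists f'.
  apply/Linf_l2P; split => //; exists 1; apply/aeW => x _; rewrite persqE.
  have [w0|w0] := eqVneq (fine (persq c f x)) 0.
    by rewrite r0// expr0n mul0e lee_fin.
  have fx : persq c f x \is a fin_num.
    by move: w0; case: (persq c f x) => //=; rewrite eqxx.
  by rewrite r2// -[X in (_ * X)%E](fineK fx) -EFinM mulVf.
have E2 : {ae mu, forall x, I x -> forall n, persq c (v n) x \is a fin_num}.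
  have := ae_foralln (fun k => persq_ae_fin c0 (hv (nu k))).
  move=> h; apply: (ae_imp h) => x {}h Ix n.
  have [_ _ /(_ n Logic.I) [k _ <-]] := nu_bij.
  exact: h.
apply: (ae_imp2 (persq_ae_fin c0 hf) E2) => x /[swap] vfin /[swap] Ix.
move=> /(_ Ix) fx; have {}vfin := vfin Ix.
have bE n : ip f' (v n) x = (r x)%:C * ip f (v n) x.
  rewrite -csumZ//; congr csum; apply/funext => k.
  by rewrite /f' rk mulrA.
have bsE : bracket_sum f' x = ((r x ^+ 2)%:E * bracket_sum f x)%E.
  rewrite /bracket_sum -esumZl ?sqr_ge0//; last by move=> n; rewrite lee_fin sqmod_ge0.
  by apply: eq_esum => n _; rewrite bE sqmodM sqmod_real EFinM.
exists (fine (persq c f x)); first exact/fine_ge0/persq_ge0.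
(* Where the weight is 0, f' carries no information; Cauchy-Schwarz shows that all brackets of f
   vanish there too. *)
have [w0|w0] := eqVneq (fine (persq c f x)) 0; last first.
  by rewrite bsE persqE !muleA -!EFinM r2// mulfV// !mul1e.
rewrite w0 !mul0e; split; last by rewrite -(fineK fx) w0.
rewrite /bracket_sum esum1// => n _; congr EFin; apply/eqP.
rewrite eq_le sqmod_ge0 andbT.
by apply: (le_trans (bracket_CS fx (vfin n))); rewrite w0 mul0r.
Qed.

End linf_family.

(** * The two equivalences for a general family *)

Lemma weak_terms f : (fun n x => ip f (v n) x * (ip f (v n) x)^*%C) =
  fun n x => (sqmod (ip f (v n) x))%:C.
Proof. by apply/funext => n; apply/funext => x; rewrite mulC_conj. Qed.

Let mterm f (n : int) : cmeasurable [set: R] f ->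
  measurable_fun I (fun x => sqmod (ip f (v n) x)).
Proof.
move=> mf; apply: measurable_sqmod; apply: measurable_bracket => //.
exact: (hv n).1.
Qed.

Lemma scaled_inner_real B f : (fun x => B%:C * ip f f x) =
  (fun x => (B * fine (persq c f x))%:C).
Proof. by apply/funext => x; rewrite bracket_self rmorphM. Qed.

Lemma weak_sum_ae f s : cmeasurable [set: R] f ->
  strong_sum c (fun n x => ip f (v n) x * (ip f (v n) x)^*%C) s ->
  {ae mu, forall x, I x -> bracket_sum f x = (complex.Re (s x))%:E}.
Proof.
move=> mf; rewrite weak_terms => hs.
apply: (strong_sum_elim c0 (fun n => mterm n mf) _ hs).
by move=> n x; exact: sqmod_ge0.
Qed.

Lemma weak_sum_exists f B : (forall n, Linf_l2 c (v n)) -> Linf_l2 c f ->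
  {ae mu, forall x, I x -> (bracket_sum f x <= B%:E * persq c f x)%E} ->
  strong_sum c (fun n x => ip f (v n) x * (ip f (v n) x)^*%C)
    (fun x => (fine (bracket_sum f x))%:C) /\
  {ae mu, forall x, I x -> bracket_sum f x \is a fin_num}.
Proof.
move=> vL /Linf_l2P[mf [M hM]] hB.
have bM : {ae mu, forall x, I x -> (bracket_sum f x <= (`|B| * `|M|)%:E)%E}.
  apply: (ae_imp2 hM hB) => x h1 h2 Ix; apply: (le_trans (h2 Ix)).
  rewrite EFinM; apply: (@le_trans _ _ (`|B|%:E * persq c f x)%E).
    by rewrite lee_wpmul2r ?persq_ge0// lee_fin ler_norm.
  by rewrite lee_wpmul2l ?lee_fin//; apply: (le_trans (h1 Ix)); rewrite lee_fin ler_norm.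
split.
  rewrite weak_terms; apply: (strong_sum_intro (fun n => mterm n mf) _ bM).
  by move=> n x; exact: sqmod_ge0.
apply: (ae_imp bM) => x h Ix; rewrite ge0_fin_numE ?bracket_sum_ge0//.
by apply: le_lt_trans (h Ix) _; rewrite ltry.
Qed.

Let mfine_bs f : cmeasurable [set: R] f -> measurable_fun I (fun x => fine (bracket_sum f x)).
Proof.
move=> mf; apply: (@measurableT_comp _ _ _ _ _ _ fine) => //.
exact: measurable_bracket_sum.
Qed.

Let mfine_persq B f : cmeasurable [set: R] f ->
  measurable_fun I (fun x => B * fine (persq c f x)).
Proof.
move=> mf; apply: measurable_funM; first exact: measurable_cst.
apply: (@measurableT_comp _ _ _ _ _ _ fine) => //.
exact: measurable_persq.
Qed.

Lemma bessel_weak_bessel B :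
  bessel [set: R] G B <-> weak_bessel c (Linf_l2 c) ip v B.
Proof.
split => [hB|[vL hw]].
- have vL n := bessel_Linf_l2 n hB; split => // f fL.
  have hf := Linf_l2_L2 fL; have hae := bessel_ae vL hB hf.
  have [hs sfin] := weak_sum_exists vL fL hae; exists (fun x => (fine (bracket_sum f x))%:C) => //.
  have /Linf_l2P[_ [M hM]] := fL; have B0 := bessel_ge0 hB.
  rewrite scaled_inner_real; apply: (Linf_le_intro (M := B * M)).
  + exact: mfine_bs hf.1.
  + exact: mfine_persq hf.1.
  + have h := ae_and hae sfin.
    apply: (ae_imp2 h (persq_ae_fin c0 hf)) => x {}h h2 Ix.
    have [h1 h3] := h Ix.
    by rewrite -lee_fin fineK// EFinM fineK// h2.
  + apply: (ae_imp2 hM (persq_ae_fin c0 hf)) => x h1 h2 Ix.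
    rewrite lerBlDr (@le_trans _ _ (B * M))//.
      by rewrite ler_wpM2l// -lee_fin fineK ?h1 ?h2.
    by rewrite lerDl fine_ge0// bracket_sum_ge0.
- have ae1 f : Linf_l2 c f -> {ae mu, forall x, I x -> (bracket_sum f x <= B%:E * persq c f x)%E}.
    move=> fL; have hf := Linf_l2_L2 fL; have [s hs /Linf_le_elim hle] := hw f fL.
    have h := ae_and (weak_sum_ae hf.1 hs) hle.
    apply: (ae_imp2 h (persq_ae_fin c0 hf)) => x {}h h2 Ix; have [-> h3] := h Ix.
    rewrite -(fineK (h2 Ix)) -EFinM lee_fin; apply: (le_trans h3).
    by rewrite bracket_self -rmorphM.
  split; first by move=> mn; exact: L2_mod_family.
  move=> f hf; rewrite (esum_family_bracket vL hf) -(integral_persq c0 hf.1).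
  have ae2 : {ae mu, forall x, I x -> (bracket_sum f x <= B%:E * persq c f x)%E}.
    have [f' fL' hff'] := normalize_Linf_l2 hf.
    apply: (ae_imp2 hff' (ae1 _ fL')) => x h1 h2 Ix; have [w w0 [-> ->]] := h1 Ix.
    by rewrite muleCA lee_wpmul2l ?lee_fin// h2.
  have mp : measurable_fun I (persq c f) by exact: measurable_persq hf.1.
  (* The sign of B is still open; |B| gives a nonnegative integrand on the larger side, as
     monotonicity of the integral asks. *)
  have le_abs : (\int[mu]_(x in I) bracket_sum f x <= `|B|%:E * \int[mu]_(x in I) persq c f x)%E.
    rewrite -ge0_integralZl//; last by move=> x _; exact: persq_ge0.
    apply: ae_ge0_le_integral => //.
    + by move=> x _; exact: bracket_sum_ge0.
    + exact: measurable_bracket_sum hf.1.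
    + by move=> x _; rewrite mule_ge0// persq_ge0.
    + exact: measurable_funeM.
    apply: (ae_imp ae2) => x h Ix; apply: (le_trans (h Ix)).
    by rewrite lee_wpmul2r ?persq_ge0// lee_fin ler_norm.
  have [B0|Bn] := lerP 0 B; first by rewrite -[X in X%:E](ger0_norm B0).
  (* For [B < 0] the fibrewise inequality forces [f] to vanish. *)
  have p0 : (\int[mu]_(x in I) persq c f x = 0)%E.
    rewrite (ae_eq_integral (cst 0%E)) ?integral_cst ?mul0e//.
    apply: (ae_imp2 ae2 (persq_ae_fin c0 hf)) => x h1 h2 Ix.
    have := le_trans (bracket_sum_ge0 f x) (h1 Ix); have := persq_ge0 c f x.
    rewrite -(fineK (h2 Ix)) -EFinM !lee_fin => h3 h4.
    congr EFin; apply/eqP; rewrite eq_le h3 andbT.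
    by rewrite -(nmulr_rge0 _ Bn).
  by move: le_abs; rewrite p0 !mule0.
Qed.

Lemma frame_weak_frame A B :
  frame [set: R] G A B <-> weak_frame c (Linf_l2 c) ip v A B.
Proof.
split => [hF|[A0 B0 hw hA]].
- have [A0 B0 hB hA] := hF; split => //; first exact/bessel_weak_bessel.
  have vL n := bessel_Linf_l2 n hB.
  move=> f fL; have hf := Linf_l2_L2 fL.
  have hae := bessel_ae vL hB hf; have hae' := frame_ae vL hF hf.
  have [hs sfin] := weak_sum_exists vL fL hae; exists (fun x => (fine (bracket_sum f x))%:C) => //.
  have /Linf_l2P[_ [M hM]] := fL.
  rewrite scaled_inner_real; apply: (Linf_le_intro (M := B * M)).
  + exact: mfine_persq hf.1.
  + exact: mfine_bs hf.1.
  + have h := ae_and hae' sfin.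
    apply: (ae_imp2 h (persq_ae_fin c0 hf)) => x {}h h2 Ix; have [h1 h3] := h Ix.
    by rewrite -lee_fin EFinM !fineK// h2.
  (* The difference in the lower inequality must be bounded to have its square root in L^oo; the
     upper inequality bounds the bracket sum by B M. *)
  + have h := ae_and hae sfin.
    have h' := ae_and h (persq_ae_fin c0 hf).
    apply: (ae_imp2 hM h') => x h1 h2 Ix; have [[h3 h4] h5] := h2 Ix.
    rewrite lerBlDr (@le_trans _ _ (B * M))//.
      rewrite -lee_fin fineK//; apply: (le_trans h3).
      by rewrite EFinM lee_wpmul2l ?lee_fin ?(ltW B0)// h1.
    by rewrite lerDl mulr_ge0 ?(ltW A0)// fine_ge0// persq_ge0.
- have hB : bessel [set: R] G B by exact/bessel_weak_bessel.
  have [vL _] := hw; split => // f hf.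
  have ae1 h : Linf_l2 c h -> {ae mu, forall x, I x -> (A%:E * persq c h x <= bracket_sum h x)%E}.
    move=> hL; have hh := Linf_l2_L2 hL; have [s hs /Linf_le_elim hle] := hA h hL.
    have k := ae_and (weak_sum_ae hh.1 hs) hle.
    apply: (ae_imp2 k (persq_ae_fin c0 hh)) => x {}k h2 Ix; have [-> h3] := k Ix.
    rewrite -(fineK (h2 Ix)) -EFinM lee_fin; apply: le_trans h3.
    by rewrite bracket_self -rmorphM.
  rewrite (esum_family_bracket vL hf) -(integral_persq c0 hf.1).
  rewrite -ge0_integralZl//; first last.
  + by rewrite lee_fin ltW.
  + by move=> x _; exact: persq_ge0.
  + exact: measurable_persq hf.1.
  apply: ae_ge0_le_integral => //.
  + by move=> x _; rewrite mule_ge0 ?persq_ge0// lee_fin ltW.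
  + by apply: measurable_funeM; exact: measurable_persq hf.1.
  + by move=> x _; exact: bracket_sum_ge0.
  + exact: measurable_bracket_sum hf.1.
  (* The module hypothesis speaks of bounded <f,f> only. Both sides scale by the same weight w, so
     the inequality passes from f' to f. *)
  have [f' fL' hff'] := normalize_Linf_l2 hf.
  apply: (ae_imp2 hff' (ae1 _ fL')) => x h1 h2 Ix; have [w w0 [-> ->]] := h1 Ix.
  by rewrite muleCA lee_wpmul2l ?lee_fin// h2.
Qed.

End family.

Theorem theorem5p9 (R : realType) (g : R -> R[i]) (a b : R)
    (hg : L2 [set: R] g) (ha : 0 < a) (hb : 0 < b) :
  let c := 1 / b in
  let e := fun n : int =>
    translation (n%:~R * a) (fun x => (1 / Num.sqrt b)%:C * g x) in
  (forall B : R,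
     bessel [set: R] (gabor g a b) B <->
     weak_bessel c (Linf_l2 c) (Linf_l2_inner c) e B) /\
  (forall A B : R,
     frame [set: R] (gabor g a b) A B <->
     weak_frame c (Linf_l2 c) (Linf_l2_inner c) e A B).
Proof.
move=> c e.
have c0 : 0 < c by rewrite divr_gt0.
have bc : b * c = 1 by rewrite /c mul1r mulfV// gt_eqF.
have hu n : L2 [set: R] (translation (n%:~R * a) g) by exact: L2_translation.
split => [B|A B].
  exact: (bessel_weak_bessel hb c0 bc hu B).
exact: (frame_weak_frame hb c0 bc hu A B).
Qed.
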